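(* Let $\Bbbk$ be a field of characteristic $0$ and let $I$ be a nonempty finite set. For any cocommutative connected bimonoid $\mathbf{h}$ in species over $\Bbbk$, $$\mathbf{h}[I]=\bigoplus_{X\vdash I}\Psi_I(\mathtt{E}_X)(\mathbf{h}[I]),$$ the sum being over all partitions $X$ of $I$, and, if $\mathbf{h}$ is finite-dimensional, then for each $X\vdash I$ $$\dim\Psi_I(\mathtt{E}_X)(\mathbf{h}[I])=k_X(\mathbf{h}).$$
   Context: Species and bimonoids. A species is a functor $\mathbf{p}$ from the category of finite sets and bijections to $\Bbbk$-vector spaces; morphisms are natural transformations; $\mathbf{p}$ is finite-dimensional if every $\mathbf{p}[I]$ is. $I=S\sqcup T$ means that $(S,T)$ is an ordered pair of disjoint, possibly empty, subsets with union $I$. The Cauchy product is $(\mathbf{p}\cdot\mathbf{q})[I]=\bigoplus_{I=S\sqcup T}\mathbf{p}[S]\otimes\mathbf{q}[T]$; with the symmetry $x\otimes y\mapsto y\otimes x$ and unit the species that is $\Bbbk$ on $\emptyset$ and $0$ elsewhere, species form a symmetric monoidal category. Monoids, comonoids and bimonoids are taken in this category, with structure maps $\mu_{S,T},\iota_\emptyset$ (product $\mathbf{a}[S]\otimes\mathbf{a}[T]\to\mathbf{a}[I]$, unit) and $\Delta_{S,T},\epsilon_\emptyset$ (coproduct $\mathbf{c}[I]\to\mathbf{c}[S]\otimes\mathbf{c}[T]$, counit); in a bimonoid, product and unit are morphisms of comonoids. Cocommutative means that $\Delta_{T,S}$ equals $\Delta_{S,T}$ followed by the swap. A bimonoid is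 connected if $\dim\mathbf{h}[\emptyset]=1$. Compositions. A composition $F=(I_1,\dots,I_k)\vDash I$ is a sequence of pairwise disjoint nonempty subsets (blocks) with union $I$; $\ell(F)=k$; $\mathrm{supp}\,F$ is the partition $\{I_1,\dots,I_k\}$. $\mu_F:\mathbf{h}[I_1]\otimes\cdots\otimes\mathbf{h}[I_k]\to\mathbf{h}[I]$ and $\Delta_F$ in the other direction are the iterated product and coproduct (identities for $k=1$). Write $F\le G$ if each block of $F$ is a union of contiguous blocks of $G$; then $\ell(G/F)=\prod_i n_i$, where $n_i$ is the number of blocks of $G$ contained in the $i$-th block of $F$. $\mathbf{\Sigma}[I]$ is the vector space with basis $\mathtt{H}_F$, $F\vDash I$. Put $\mathtt{Q}_F=\sum_{G:\,F\le G}(-1)^{\ell(G)-\ell(F)}\frac{1}{\ell(G/F)}\mathtt{H}_G$. For a partition $X\vdash I$ with $\ell(X)$ blocks, the Garsia–Reutenauer idempotent is $\mathtt{E}_X=\frac{1}{\ell(X)!}\sum_{F:\,\mathrm{supp}F=X}\mathtt{Q}_F\in\mathbf{\Sigma}[I]$. For $z=\sum_F a_F\mathtt{H}_F\in\mathbf{\Sigma}[I]$, $\Psi_I(z)=\sum_F a_F\,\mu_F\Delta_F\in\mathrm{End}_\Bbbk(\mathbf{h}[I])$. Partitions of $I$ are ordered by $X\le Y$ if each block of $X$ is a union of blocks of $Y$ (so $\{I\}$ is the minimum); $\mu(X,Y)$ is the Möbius function of this poset. Put $\mathbf{h}(X)=\bigotimes_{B\in X}\mathbf{h}[B]$. For finite-dimensional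 $\mathbf{h}$, $k_X(\mathbf{h})=\sum_{Y:\,Y\ge X}\mu(X,Y)\dim_\Bbbk\mathbf{h}(Y)$. *)

(* Defs.v *)
From HB Require Import structures.
From mathcomp Require Import all_boot all_order all_algebra.
From mathcomp Require Import sesquilinear generic_quotient boolp.

Set Implicit Arguments.
Unset Strict Implicit.
Unset Printing Implicit Defensive.

Import GRing.Theory.
Local Open Scope ring_scope.
Local Open Scope quotient_scope.

Section Tensor.
Variables (k : fieldType) (V W : lmodType k).

Definition tsum (U : lmodType k) (b : V -> W -> U) (s : seq (V * W)) : U :=
  \sum_(p <- s) b p.1 p.2.

(* The tensor product is built from formal sums of pure tensors (scalars are
   absorbed by the first factor), two formal sums being identified when no
   bilinear map separates them; [tlift_pure], [tlift_linear] and [tlift_unique]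
   are the universal property. *)
Definition teqv (s t : seq (V * W)) : bool :=
  `[< forall (U : lmodType k) (b : V -> W -> U),
        bilinear_for *:%R *:%R b -> tsum b s = tsum b t >].

Lemma teqv_refl : reflexive teqv. Proof. by move=> s; apply/asboolP. Qed.
Lemma teqv_sym : symmetric teqv.
Proof.
by move=> s t; apply/asboolP/asboolP => h U b hb; rewrite (h U b hb).
Qed.
Lemma teqv_trans : transitive teqv.
Proof.
move=> t s u /asboolP h1 /asboolP h2; apply/asboolP => U b hb.
by rewrite h1 ?h2.
Qed.

Canonical teqv_equiv := EquivRel teqv teqv_refl teqv_sym teqv_trans.

Definition tensor : Type := {eq_quot teqv_equiv}.
HB.instance Definition _ := Choice.on tensor.

Definition tcls (s : seq (V * W)) : tensor := \pi_{eq_quot teqv_equiv} s.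
Definition trep (t : tensor) : seq (V * W) := @repr _ {eq_quot teqv_equiv} t.

Definition tpure (v : V) (w : W) : tensor := tcls [:: (v, w)].

Definition tlift (U : lmodType k) (b : V -> W -> U) (t : tensor) : U :=
  tsum b (trep t).

Lemma trepK : cancel trep tcls. Proof. exact: reprK. Qed.

Lemma tclsP s t : tcls s = tcls t <->
  forall (U : lmodType k) (b : V -> W -> U),
    bilinear_for *:%R *:%R b -> tsum b s = tsum b t.
Proof.
split=> [/eqquotP/asboolP //| h]; apply/eqquotP; exact/asboolP.
Qed.

Lemma tlift_cls (U : lmodType k) (b : V -> W -> U) s :
  bilinear_for *:%R *:%R b -> tlift b (tcls s) = tsum b s.
Proof. by move: b; apply/(tclsP _ s) : U; exact: trepK. Qed.

Lemma tsum_cat (U : lmodType k) (b : V -> W -> U) s t :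
  tsum b (s ++ t) = tsum b s + tsum b t.
Proof. exact: big_cat. Qed.

Definition tscale_rep (c : k) (s : seq (V * W)) := [seq (c *: p.1, p.2) | p <- s].

Lemma tsum_scale (U : lmodType k) (b : V -> W -> U) c s :
  bilinear_for *:%R *:%R b -> tsum b (tscale_rep c s) = c *: tsum b s.
Proof.
move=> [hb _]; rewrite /tsum big_map scaler_sumr; apply: eq_bigr => p _ /=.
exact: scalable_linear (hb p.2) c p.1.
Qed.

Definition tzero := tcls [::].
Definition tadd t u := tcls (trep t ++ trep u).
Definition tscale c t := tcls (tscale_rep c (trep t)).
Definition topp t := tscale (-1) t.

Lemma tlift0 (U : lmodType k) (b : V -> W -> U) :
  bilinear_for *:%R *:%R b -> tlift b tzero = 0.
Proof. by move=> hb; rewrite tlift_cls // /tsum big_nil. Qed.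
Lemma tliftD (U : lmodType k) (b : V -> W -> U) t u :
  bilinear_for *:%R *:%R b -> tlift b (tadd t u) = tlift b t + tlift b u.
Proof. by move=> hb; rewrite tlift_cls // tsum_cat. Qed.
Lemma tliftZ (U : lmodType k) (b : V -> W -> U) c t :
  bilinear_for *:%R *:%R b -> tlift b (tscale c t) = c *: tlift b t.
Proof. by move=> hb; rewrite tlift_cls // tsum_scale. Qed.

Lemma tlift_ext t u : (forall (U : lmodType k) (b : V -> W -> U),
  bilinear_for *:%R *:%R b -> tlift b t = tlift b u) -> t = u.
Proof. by move=> h; rewrite -[t]trepK -[u]trepK; apply/tclsP. Qed.

Let taddA : associative tadd.
Proof. by move=> t u v; apply: tlift_ext => U b hb; rewrite !tliftD ?addrA. Qed.
Let taddC : commutative tadd.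
Proof. by move=> t u; apply: tlift_ext => U b hb; rewrite !tliftD // addrC. Qed.
Let tadd0 : left_id tzero tadd.
Proof. by move=> t; apply: tlift_ext => U b hb; rewrite tliftD ?tlift0 ?add0r. Qed.
Let taddN : left_inverse tzero topp tadd.
Proof.
move=> t; apply: tlift_ext => U b hb.
by rewrite tliftD ?tlift0 // tliftZ // scaleN1r addNr.
Qed.
HB.instance Definition _ := GRing.isZmodule.Build tensor taddA taddC tadd0 taddN.

Let tscaleA a b t : tscale a (tscale b t) = tscale (a * b) t.
Proof. by apply: tlift_ext => U f hf; rewrite !tliftZ // scalerA. Qed.
Let tscale1 : left_id 1 tscale.
Proof. by move=> t; apply: tlift_ext => U f hf; rewrite tliftZ // scale1r. Qed.
Let tscaleDr : right_distributive tscale +%R.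
Proof.
by move=> a t u; apply: tlift_ext => U f hf; rewrite !(tliftZ, tliftD) // scalerDr.
Qed.
Let tscaleDl t : {morph tscale^~ t : a b / a + b}.
Proof.
by move=> a b; apply: tlift_ext => U f hf; rewrite !(tliftZ, tliftD) // scalerDl.
Qed.
HB.instance Definition _ := GRing.Zmodule_isLmodule.Build k tensor
  tscaleA tscale1 tscaleDr tscaleDl.

Lemma tlift_pure (U : lmodType k) (b : V -> W -> U) v w :
  bilinear_for *:%R *:%R b -> tlift b (tpure v w) = b v w.
Proof. by move=> hb; rewrite tlift_cls // /tsum big_seq1. Qed.

Lemma tpure_bilinear : bilinear_for *:%R *:%R tpure.
Proof.
split=> [w c v v' | v c w w']; apply: tlift_ext => U b hb;
  rewrite tliftD // tliftZ // !tlift_pure //; first exact: hb.1.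
exact: hb.2.
Qed.

Lemma tlift_linear (U : lmodType k) (b : V -> W -> U) :
  bilinear_for *:%R *:%R b -> linear (tlift b).
Proof. by move=> hb c t u; rewrite tliftD // tliftZ. Qed.

Lemma tcls_sum s : tcls s = \sum_(p <- s) tpure p.1 p.2.
Proof.
elim: s => [|p s IHs]; first by rewrite big_nil.
rewrite big_cons -IHs; apply: tlift_ext => U b hb.
rewrite -[_ + _]/(tadd _ _) tliftD // /tpure !tlift_cls // -tsum_cat /=.
by case: p.
Qed.

Lemma tlift_unique (U : lmodType k) (f g : {linear tensor -> U}) :
  (forall v w, f (tpure v w) = g (tpure v w)) -> f =1 g.
Proof.
move=> fg t; rewrite -[t]trepK tcls_sum !linear_sum.
by apply: eq_bigr => p _; apply: fg.
Qed.

End Tensor.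

Notation "V ⊗ W" := (tensor V W) (at level 40, left associativity) : type_scope.

Section TensorMaps.
Variable k : fieldType.
Implicit Types V W U X : lmodType k.

Definition tmap V V' W W' (f : V -> V') (g : W -> W') : V ⊗ W -> V' ⊗ W' :=
  tlift (fun v w => tpure (f v) (g w)).

Definition tswap V W : V ⊗ W -> W ⊗ V := tlift (fun v w => tpure w v).

Definition tassoc V W U : (V ⊗ W) ⊗ U -> V ⊗ (W ⊗ U) :=
  tlift (fun t u => tlift (fun v w => tpure v (tpure w u)) t).

Definition tinterchange V W U X : (V ⊗ W) ⊗ (U ⊗ X) -> (V ⊗ U) ⊗ (W ⊗ X) :=
  tlift (fun s t =>
    tlift (fun v w => tlift (fun u x => tpure (tpure v u) (tpure w x)) t) s).

Lemma tpure_comp_bilinear V V' W W' (f : V -> V') (g : W -> W') :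
  linear f -> linear g ->
  bilinear_for *:%R *:%R (fun v w => tpure (f v) (g w)).
Proof.
move=> lf lg; split=> [w c v v' | v c w w'].
  by rewrite lf; apply: (tpure_bilinear _ _).1.
by rewrite lg; apply: (tpure_bilinear _ _).2.
Qed.

Lemma tmap_linear V V' W W' (f : V -> V') (g : W -> W') :
  linear f -> linear g -> linear (tmap f g).
Proof. by move=> lf lg; apply/tlift_linear/tpure_comp_bilinear. Qed.

Lemma tmap_pure V V' W W' (f : V -> V') (g : W -> W') v w :
  linear f -> linear g -> tmap f g (tpure v w) = tpure (f v) (g w).
Proof. by move=> lf lg; apply/tlift_pure/tpure_comp_bilinear. Qed.

Lemma tswap_bilinear V W : bilinear_for *:%R *:%R (fun (v : V) (w : W) => tpure w v).
Proof.
split=> [w c v v' | v c w w']; first exact: (tpure_bilinear _ _).2.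
exact: (tpure_bilinear _ _).1.
Qed.

Lemma tswap_pure V W (v : V) (w : W) : tswap (tpure v w) = tpure w v.
Proof. exact/tlift_pure/tswap_bilinear. Qed.

(* A family of bilinear maps depending linearly on a parameter. *)
Lemma tlift_param V W U X (b : U -> V -> W -> X) :
    (forall u, bilinear_for *:%R *:%R (b u)) ->
    (forall v w, linear (fun u => b u v w)) ->
  forall t, linear (fun u => tlift (b u) t).
Proof.
move=> hb lb t c u u'; rewrite -[t]trepK !tlift_cls // /tsum scaler_sumr -big_split.
by apply: eq_bigr => p _; apply: lb.
Qed.

Lemma tassoc_bilinear V W U : bilinear_for *:%R *:%R
  (fun (t : V ⊗ W) (u : U) => tlift (fun v w => tpure v (tpure w u)) t).
Proof.
have hb (u : U) : bilinear_for *:%R *:%R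
    (fun (v : V) (w : W) => tpure v (tpure w u)).
  split=> [w c v v' | v c w w']; first exact: (tpure_bilinear _ _).1.
  by rewrite (tpure_bilinear _ _).1 (tpure_bilinear _ _).2.
split=> [u | t]; first exact: tlift_linear.
apply: (tlift_param hb) => v w c u u'.
by rewrite (tpure_bilinear _ _).2 (tpure_bilinear _ _).2.
Qed.

Lemma tassoc_pure V W U (v : V) (w : W) (u : U) :
  tassoc (tpure (tpure v w) u) = tpure v (tpure w u).
Proof.
rewrite /tassoc (tlift_pure _ _ (tassoc_bilinear V W U)) tlift_pure //.
split=> [w' c v1 v2 | v' c w1 w2]; first exact: (tpure_bilinear _ _).1.
by rewrite (tpure_bilinear _ _).1 (tpure_bilinear _ _).2.
Qed.

Lemma tinterchange_bilinear1 V W U X (v : V) (w : W) : bilinear_for *:%R *:%R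
  (fun (u : U) (x : X) => tpure (tpure v u) (tpure w x)).
Proof.
split=> [x c u u' | u c x x'].
  by rewrite (tpure_bilinear _ _).2 (tpure_bilinear _ _).1.
by rewrite !(tpure_bilinear _ _).2.
Qed.

Lemma tinterchange_bilinear2 V W U X (t : U ⊗ X) : bilinear_for *:%R *:%R
  (fun (v : V) (w : W) =>
     tlift (fun u x => tpure (tpure v u) (tpure w x)) t).
Proof.
split=> [w | v].
  apply: (tlift_param (b := fun v u x => tpure (tpure v u) (tpure w x))).
    by move=> v; apply: tinterchange_bilinear1.
  by move=> u x c v v'; rewrite !(tpure_bilinear _ _).1.
apply: (tlift_param (b := fun w u x => tpure (tpure v u) (tpure w x))).
  by move=> w; apply: tinterchange_bilinear1.
by move=> u x c w w'; rewrite (tpure_bilinear _ _).1 (tpure_bilinear _ _).2.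
Qed.

Lemma tinterchange_bilinear V W U X : bilinear_for *:%R *:%R
  (fun (s : V ⊗ W) (t : U ⊗ X) =>
    tlift (fun v w => tlift (fun u x => tpure (tpure v u) (tpure w x)) t) s).
Proof.
split=> [t | s]; first exact/tlift_linear/tinterchange_bilinear2.
apply: tlift_param => [t|v w]; first exact: tinterchange_bilinear2.
exact/tlift_linear/tinterchange_bilinear1.
Qed.

Lemma tinterchange_pure V W U X (v : V) (w : W) (u : U) (x : X) :
  tinterchange (tpure (tpure v w) (tpure u x)) =
  tpure (tpure v u) (tpure w x).
Proof.
rewrite /tinterchange (tlift_pure _ _ (tinterchange_bilinear V W U X)).
by rewrite tlift_pure ?tlift_pure //;
  [exact: tinterchange_bilinear1 | exact: tinterchange_bilinear2].
Qed.

(* [b] is a basis of the linear subspace [P] of [V]. *)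
Definition is_basis V (P : V -> Prop) (n : nat) (b : 'I_n -> V) : Prop :=
  (forall i, P (b i)) /\
  forall v, P v -> exists! c : {ffun 'I_n -> k}, v = \sum_i c i *: b i.

Definition has_dim V (P : V -> Prop) (n : nat) : Prop :=
  exists b : 'I_n -> V, is_basis P b.

Definition fullspace V : V -> Prop := fun=> True.

(* 0 by convention when [P] is not finite-dimensional. *)
Definition dimension V (P : V -> Prop) : nat :=
  if pselect (exists n, has_dim P n) is left e then projT1 (cid e) else 0.

Definition range V W (f : V -> W) : W -> Prop := fun w => exists v, w = f v.

Definition direct_sum (J : finType) V (P : J -> V -> Prop) : Prop :=
  forall v, exists! w : {ffun J -> V},
    (forall j, P j (w j)) /\ v = \sum_j w j.

End TensorMaps.

Arguments fullspace {k} V _.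

Record species (k : fieldType) := Species {
  sp_obj :> finType -> lmodType k;
  sp_map : forall (I J : finType) (f : I -> J),
    bijective f -> {linear sp_obj I -> sp_obj J};
  sp_map_id : forall (I : finType) (b : bijective (@id I)) x,
    sp_map b x = x;
  sp_map_comp : forall (I J K : finType) (f : I -> J) (g : J -> K)
      (bf : bijective f) (bg : bijective g) (bgf : bijective (g \o f)) x,
    sp_map bgf x = sp_map bg (sp_map bf x)
}.

Section Decompositions.

(* A subset regarded as a finite set in its own right. *)
Definition sset (I : finType) (S : {set I}) : finType := {x : I | x \in S}.

(* A = S ⊔ T *)
Definition decomp (I : finType) (A S T : {set I}) : bool :=
  (S :|: T == A) && [disjoint S & T].

Variables I J : finType.

Definition sset_map (f : I -> J) (S : {set I}) (x : sset S) : sset (f @: S) :=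
  exist _ (f (val x)) (imset_f f (valP x)).

Lemma sset_map_bij f S : bijective f -> bijective (@sset_map f S).
Proof.
move=> bf; have fI := bij_inj bf; apply: inj_card_bij.
  by move=> x y /(congr1 val)/fI xy; apply: val_inj.
by rewrite !card_sig card_imset.
Qed.

Lemma decomp_image (f : I -> J) (S T : {set I}) :
  bijective f -> decomp [set: I] S T -> decomp [set: J] (f @: S) (f @: T).
Proof.
move=> bf /andP[/eqP uST dST]; have fI := bij_inj bf.
rewrite /decomp -imsetU uST imset_disjoint ?dST ?andbT; last first.
  exact: fI.
apply/eqP/setP=> y; rewrite inE; case: bf => g _ gK.
by rewrite -[y]gK imset_f.
Qed.

(* The subset S of A ⊆ I, regarded as a subset of the finite set A. *)
Definition rset (A S : {set I}) : {set sset A} := [set a | val a \in S].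

Lemma in_rset (A S : {set I}) (a : sset A) : (a \in rset A S) = (val a \in S).
Proof. by rewrite inE. Qed.

Definition rset_val (A S : {set I}) (x : sset (rset A S)) : sset S :=
  exist _ (val (val x)) (etrans (esym (in_rset _ _)) (valP x)).

Lemma rset_val_bij (A S : {set I}) : S \subset A -> bijective (@rset_val A S).
Proof.
move=> sSA; apply: inj_card_bij; first by move=> x y /(congr1 val) xy; do 2!apply: val_inj.
rewrite !card_sig -(card_imset _ val_inj); apply/subset_leq_card/subsetP => x xS.
by apply/imsetP; exists (exist _ x (subsetP sSA _ xS)); rewrite ?inE.
Qed.

Definition rset_inc (A S : {set I}) (sSA : S \subset A) (x : sset S) :
    sset (rset A S) :=
  let a : sset A := exist _ (val x) (subsetP sSA _ (valP x)) in
  exist _ a (etrans (in_rset S a) (valP x)).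

Lemma rset_inc_bij (A S : {set I}) (sSA : S \subset A) :
  bijective (rset_inc sSA).
Proof.
exists (@rset_val A S) => x; first exact: val_inj.
by apply: val_inj; apply: val_inj.
Qed.

Lemma decomp_rset (A S T : {set I}) :
  decomp A S T -> decomp [set: sset A] (rset A S) (rset A T).
Proof.
move=> /andP[/eqP uST dST]; apply/andP; split.
  by apply/eqP/setP=> x; rewrite !inE -in_setU uST (valP x).
rewrite disjoint_subset; apply/subsetP=> x; rewrite !inE => xS.
by rewrite (disjointFr dST xS).
Qed.

Lemma decomp_subl (A S T : {set I}) : decomp A S T -> S \subset A.
Proof. by move=> /andP[/eqP<- _]; apply: subsetUl. Qed.

Lemma decomp_subr (A S T : {set I}) : decomp A S T -> T \subset A.
Proof. by move=> /andP[/eqP<- _]; apply: subsetUr. Qed.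

Lemma of_void_bij (E : {set I}) : E = set0 -> bijective (@of_void (sset E)).
Proof.
move=> E0; apply: inj_card_bij; first by case.
by rewrite card_sig E0 eq_card0 // => x; rewrite !inE.
Qed.

Lemma to_void_subproof (x : sset (set0 : {set I})) : False.
Proof. by have := valP x; rewrite inE. Qed.

Definition to_void (x : sset (set0 : {set I})) : void :=
  False_rect void (to_void_subproof x).

Lemma to_void_bij : bijective to_void.
Proof. by exists (@of_void _) => [x|[]]; case: (to_void_subproof x). Qed.

Lemma sset_setT_bij (A : {set I}) : A = [set: I] ->
  bijective (val : sset A -> I).
Proof.
move=> A1; apply: inj_card_bij; first exact: val_inj.
by rewrite card_sig A1 cardsT.
Qed.

Definition to_sset (A : {set I}) (A1 : A = [set: I]) (x : I) : sset A :=
  exist _ x (eq_ind_r (fun B : {set I} => x \in B) (in_setT x) A1).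

Lemma to_sset_bij (A : {set I}) (A1 : A = [set: I]) : bijective (to_sset A1).
Proof. by exists val => // x; apply: val_inj. Qed.

End Decompositions.

Record bimonoid_data (k : fieldType) := BimonoidData {
  bm_species :> species k;
  bm_mu : forall (I : finType) (S T : {set I}), decomp [set: I] S T ->
    {linear bm_species (sset S) ⊗ bm_species (sset T) -> bm_species I};
  bm_iota : {linear k^o -> bm_species void};
  bm_Delta : forall (I : finType) (S T : {set I}), decomp [set: I] S T ->
    {linear bm_species I -> bm_species (sset S) ⊗ bm_species (sset T)};
  bm_eps : {linear bm_species void -> k^o}
}.

Section Relative.
Variables (k : fieldType) (h : bimonoid_data k) (U : finType).

(* The structure maps for a decomposition A = S ⊔ T of a subset A of U, obtained
   from those of the finite set A by identifying S, T ⊆ U with subsets of A. *)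
Definition mu_in (A S T : {set U}) (d : decomp A S T) :
    h (sset S) ⊗ h (sset T) -> h (sset A) :=
  fun t => bm_mu h (decomp_rset d)
    (tmap (sp_map h (rset_inc_bij (decomp_subl d)))
          (sp_map h (rset_inc_bij (decomp_subr d))) t).

Definition Delta_in (A S T : {set U}) (d : decomp A S T) :
    h (sset A) -> h (sset S) ⊗ h (sset T) :=
  fun x => tmap (sp_map h (rset_val_bij (decomp_subl d)))
                (sp_map h (rset_val_bij (decomp_subr d)))
             (bm_Delta h (decomp_rset d) x).

Definition iota_in : k -> h (sset (set0 : {set U})) :=
  fun c => sp_map h (of_void_bij (erefl set0)) (bm_iota h c).

Definition eps_in : h (sset (set0 : {set U})) -> k :=
  fun x => bm_eps h (sp_map h (@to_void_bij U) x).

End Relative.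

Section Laws.
Variables (k : fieldType) (h : bimonoid_data k).

Definition mu_natural : Prop :=
  forall (I J : finType) (f : I -> J) (bf : bijective f) (S T : {set I})
      (d : decomp [set: I] S T) x,
    sp_map h bf (bm_mu h d x) =
    bm_mu h (decomp_image bf d)
      (tmap (sp_map h (sset_map_bij S bf)) (sp_map h (sset_map_bij T bf)) x).

Definition Delta_natural : Prop :=
  forall (I J : finType) (f : I -> J) (bf : bijective f) (S T : {set I})
      (d : decomp [set: I] S T) x,
    bm_Delta h (decomp_image bf d) (sp_map h bf x) =
    tmap (sp_map h (sset_map_bij S bf)) (sp_map h (sset_map_bij T bf))
      (bm_Delta h d x).

Definition mu_assoc : Prop :=
  forall (U : finType) (A R S T RS ST : {set U})
      (dRS : decomp RS R S) (dRS_T : decomp A RS T)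
      (dST : decomp ST S T) (dR_ST : decomp A R ST)
      (x : (h (sset R) ⊗ h (sset S)) ⊗ h (sset T)),
    mu_in dRS_T (tmap (mu_in dRS) id x) =
    mu_in dR_ST (tmap id (mu_in dST) (tassoc x)).

Definition Delta_coassoc : Prop :=
  forall (U : finType) (A R S T RS ST : {set U})
      (dRS : decomp RS R S) (dRS_T : decomp A RS T)
      (dST : decomp ST S T) (dR_ST : decomp A R ST) (x : h (sset A)),
    tassoc (tmap (Delta_in dRS) id (Delta_in dRS_T x)) =
    tmap id (Delta_in dST) (Delta_in dR_ST x).

Definition mu_unit : Prop :=
  forall (U : finType) (A : {set U})
      (dl : decomp A set0 A) (dr : decomp A A set0) (x : h (sset A)),
    mu_in dl (tpure (iota_in h U 1) x) = x /\
    mu_in dr (tpure x (iota_in h U 1)) = x.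

Definition Delta_counit : Prop :=
  forall (U : finType) (A : {set U})
      (dl : decomp A set0 A) (dr : decomp A A set0) (x : h (sset A)),
    tlift (fun y z => eps_in y *: z) (Delta_in dl x) = x /\
    tlift (fun y z => eps_in z *: y) (Delta_in dr x) = x.

(* The product is a morphism of comonoids. *)
Definition mu_Delta_compat : Prop :=
  forall (U : finType) (I S T S' T' A B C D : {set U})
      (dI : decomp I S T) (dI' : decomp I S' T')
      (dS : decomp S A B) (dT : decomp T C D)
      (dS' : decomp S' A C) (dT' : decomp T' B D)
      (x : h (sset S) ⊗ h (sset T)),
    Delta_in dI' (mu_in dI x) =
    tmap (mu_in dS') (mu_in dT')
      (tinterchange (tmap (Delta_in dS) (Delta_in dT) x)).

Definition mu_eps_compat : Prop :=
  forall (U : finType) (d : decomp set0 set0 set0)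
      (x y : h (sset (set0 : {set U}))),
    eps_in (mu_in d (tpure x y)) = eps_in x * eps_in y.

(* The unit is a morphism of comonoids. *)
Definition iota_Delta_compat : Prop :=
  forall (U : finType) (d : decomp set0 set0 set0),
    Delta_in d (iota_in h U 1) = tpure (iota_in h U 1) (iota_in h U 1).

Definition iota_eps_compat : Prop := bm_eps h (bm_iota h 1) = 1.

Record is_monoid : Prop := {
  monoid_natural : mu_natural;
  monoid_assoc : mu_assoc;
  monoid_unit : mu_unit }.

Record is_comonoid : Prop := {
  comonoid_natural : Delta_natural;
  comonoid_coassoc : Delta_coassoc;
  comonoid_counit : Delta_counit }.

Record is_bimonoid : Prop := {
  bimonoid_monoid : is_monoid;
  bimonoid_comonoid : is_comonoid;
  bimonoid_mu_Delta : mu_Delta_compat;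
  bimonoid_mu_eps : mu_eps_compat;
  bimonoid_iota_Delta : iota_Delta_compat;
  bimonoid_iota_eps : iota_eps_compat }.

Lemma decompC (I : finType) (A S T : {set I}) : decomp A S T -> decomp A T S.
Proof. by rewrite /decomp setUC disjoint_sym. Qed.

Definition cocommutative : Prop :=
  forall (I : finType) (S T : {set I}) (d : decomp [set: I] S T) (x : h I),
    bm_Delta h (decompC d) x = tswap (bm_Delta h d x).

Definition connected : Prop := has_dim (fullspace (h void)) 1.

Definition finite_dimensional : Prop :=
  forall I : finType, exists n, has_dim (fullspace (h I)) n.

End Laws.

Record bimonoid (k : fieldType) := Bimonoid {
  bm_data :> bimonoid_data k;
  bm_laws : is_bimonoid bm_data }.

Section Compositions.
Variable I : finType.

Definition pairwise_disjoint (s : seq {set I}) : bool :=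
  pairwise (fun A B : {set I} => [disjoint A & B]) s.

Definition is_composition (s : seq {set I}) : bool :=
  [&& all (fun B => B != set0) s, pairwise_disjoint s
    & \bigcup_(B <- s) B == [set: I]].

Lemma disjoint_bigcup_seq (B : {set I}) (s : seq {set I}) :
  all (fun C : {set I} => [disjoint B & C]) s -> [disjoint B & \bigcup_(C <- s) C].
Proof.
elim: s => [_|C s IHs /= /andP[BC Bs]].
  by rewrite big_nil -setI_eq0 setI0.
by rewrite big_cons -setI_eq0 setIUr setU_eq0 !setI_eq0 BC IHs.
Qed.

Lemma size_pairwise_disjoint (s : seq {set I}) :
  all (fun B => B != set0) s -> pairwise_disjoint s ->
  (size s <= #|\bigcup_(B <- s) B|)%N.
Proof.
elim: s => [|B s IHs] //= /andP[B0 s0] /andP[Bs ds]; rewrite big_cons.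
rewrite cardsU (disjoint_setI0 (disjoint_bigcup_seq Bs)) cards0 subn0 -add1n.
by rewrite leq_add ?card_gt0 ?IHs.
Qed.

(* Bounding the length makes the type finite; nothing is lost. *)
Lemma size_composition (s : seq {set I}) : is_composition s -> (size s <= #|I|)%N.
Proof.
by case/and3P=> s0 ds /eqP us; rewrite -cardsT -us size_pairwise_disjoint.
Qed.

Definition composition : finType :=
  {F : {bseq #|I| of {set I}} | is_composition F}.

Definition blocks (F : composition) : seq {set I} := val F.

Definition supp (F : composition) : {set {set I}} := [set B in blocks F].

(* F ≤ G: the blocks of F, in order, are the unions of the members of a cutting
   of the sequence of blocks of G into contiguous pieces. *)
Definition comp_le (F G : composition) : bool :=
  `[< exists gs : seq (seq {set I}),
        flatten gs = blocks G /\
        [seq \bigcup_(C <- g) C | g <- gs] = blocks F >].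

(* ℓ(G/F) *)
Definition rel_length (G F : composition) : nat :=
  \prod_(B <- blocks F) count (fun C : {set I} => C \subset B) (blocks G).

Definition set_partition : finType :=
  {X : {set {set I}} | partition X [set: I]}.

Definition part_le (X Y : set_partition) : bool :=
  [forall B in val X, [exists Z : {set {set I}}, (Z \subset val Y) && (B == cover Z)]].

End Compositions.

Section Moebius.
Variables (T : finType) (le : rel T).

Fixpoint moebius_rec (n : nat) (x y : T) : int :=
  if n is m.+1 then
    if x == y then 1
    else if le x y then
      - \sum_(z | [&& le x z, le z y & z != y]) moebius_rec m x z
    else 0
  else 0.

(* Every chain of T has at most #|T| elements, so #|T| levels of recursion
   suffice; see [moebius_sum]. *)
Definition moebius : T -> T -> int := moebius_rec #|T|.

Hypotheses (lexx : reflexive le) (le_anti : antisymmetric le)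
  (le_trans : transitive le).

Let itv x y := [set z | [&& le x z, le z y & z != y]].

Let itv_lt x y z : z \in itv x y -> (#|itv x z| < #|itv x y|)%N.
Proof.
move=> zI; apply: proper_card; apply/properP; split.
  apply/subsetP=> t; move: zI; rewrite !inE => /and3P[xz zy zNy] /and3P[-> tz tNz].
  rewrite (le_trans tz zy) /=; apply: contraNneq zNy => tE.
  by apply/eqP/le_anti; rewrite zy -tE.
by exists z => //; rewrite inE eqxx !andbF.
Qed.

Let moebius_stable n m x y : (#|itv x y| < n)%N -> (#|itv x y| < m)%N ->
  moebius_rec n x y = moebius_rec m x y.
Proof.
elim: n m y => [|n IHn] [|m] y //= ltn ltm.
case: ifP => // _; case: ifP => // _; congr (- _); apply: eq_bigr => z zI.
have zlt : (#|itv x z| < #|itv x y|)%N by apply: itv_lt; rewrite inE.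
by apply: IHn; apply: leq_trans zlt _; rewrite -ltnS.
Qed.

Lemma moebius_sum (x y : T) : le x y ->
  \sum_(z | le x z && le z y) moebius x z = (x == y)%:R.
Proof.
move=> xy; rewrite (bigD1 y) /=; last by rewrite xy lexx.
have itvT z : (#|itv x z| < #|T|)%N.
  rewrite -cardsT; apply: proper_card; apply/properP; split; first exact: subsetT.
  by exists z; rewrite ?inE // eqxx !andbF.
rewrite /moebius (@moebius_stable _ #|T|.+1) ?(ltnW (itvT y)) //=; last first.
  exact: leq_trans (itvT y) (leqnSn _).
case: eqVneq => [<-|xNy].
  rewrite big1 ?addr0 // => z /andP[/andP[xz zx] zNx].
  by case/eqP: zNx; apply: le_anti; rewrite zx.
rewrite xy; apply/eqP; rewrite addrC subr_eq0; apply/eqP; apply: eq_bigl => z.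
by rewrite andbA.
Qed.

End Moebius.

Section Psi.
Variables (k : fieldType) (h : bimonoid_data k) (I : finType).

(* h[B] ⊗ (h[C] ⊗ (...)) for a nonempty sequence of blocks B, C, ... *)
Fixpoint tensor1 (B : {set I}) (s : seq {set I}) : lmodType k :=
  if s is C :: s' then h (sset B) ⊗ tensor1 C s' else h (sset B).

Definition tensor_blocks (s : seq {set I}) : lmodType k :=
  if s is B :: s' then tensor1 B s' else k^o.

Fixpoint union1 (B : {set I}) (s : seq {set I}) : {set I} :=
  if s is C :: s' then B :|: union1 C s' else B.

Lemma union1E (B : {set I}) (s : seq {set I}) : union1 B s = \bigcup_(C <- B :: s) C.
Proof.
elim: s B => [|C s IHs] B /=; first by rewrite big_seq1.
by rewrite big_cons -IHs.
Qed.

Lemma pairwise_disjoint_behead (B : {set I}) (s : seq {set I}) :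
  pairwise_disjoint (B :: s) -> pairwise_disjoint s.
Proof. by case/andP. Qed.

Lemma decomp_cons (B C : {set I}) (s : seq {set I}) : pairwise_disjoint [:: B, C & s] ->
  decomp (B :|: union1 C s) B (union1 C s).
Proof.
by case/andP=> Bs _; rewrite /decomp eqxx union1E disjoint_bigcup_seq.
Qed.

Fixpoint mu1 (B : {set I}) (s : seq {set I}) :
    pairwise_disjoint (B :: s) -> tensor1 B s -> h (sset (union1 B s)) :=
  match s with
  | [::] => fun _ x => x
  | C :: s' => fun d x =>
      mu_in (decomp_cons d) (tmap id (mu1 (pairwise_disjoint_behead d)) x)
  end.

Fixpoint Delta1 (B : {set I}) (s : seq {set I}) :
    pairwise_disjoint (B :: s) -> h (sset (union1 B s)) -> tensor1 B s :=
  match s with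
  | [::] => fun _ x => x
  | C :: s' => fun d x =>
      tmap id (Delta1 (pairwise_disjoint_behead d)) (Delta_in (decomp_cons d) x)
  end.

Lemma composition_disjoint (s : seq {set I}) :
  is_composition s -> pairwise_disjoint s.
Proof. by case/and3P. Qed.

Lemma composition_union (B : {set I}) (s : seq {set I}) : is_composition (B :: s) -> union1 B s = [set: I].
Proof. by case/and3P=> _ _ /eqP <-; apply: union1E. Qed.

Lemma composition_nil : is_composition (Nil {set I}) -> bijective (@of_void I).
Proof.
rewrite /is_composition /= big_nil => /eqP I0.
by apply: inj_card_bij; [case | rewrite -cardsT -I0 cards0].
Qed.

Lemma composition_nil_void : is_composition (Nil {set I}) -> I -> void.
Proof.
rewrite /is_composition /= big_nil => /eqP I0 x.
by have := in_setT x; rewrite -I0 inE.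
Qed.

Lemma composition_nil_void_bij (c : is_composition (Nil {set I})) :
  bijective (composition_nil_void c).
Proof. by exists (@of_void I) => [x|[]]; case: (composition_nil_void c x). Qed.

(* The set I is distinct from the subset [set: I] regarded as a set; the
   structure maps are transported along the inclusion of the latter. *)
Definition mu_seq (s : seq {set I}) :
    is_composition s -> tensor_blocks s -> h I :=
  match s with
  | [::] => fun c a => sp_map h (composition_nil c) (bm_iota h a)
  | B :: s' => fun c x =>
      sp_map h (sset_setT_bij (composition_union c))
        (mu1 (composition_disjoint c) x)
  end.

Definition Delta_seq (s : seq {set I}) :
    is_composition s -> h I -> tensor_blocks s :=
  match s with
  | [::] => fun c x => bm_eps h (sp_map h (composition_nil_void_bij c) x)
  | B :: s' => fun c x =>
      Delta1 (composition_disjoint c)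
        (sp_map h (to_sset_bij (composition_union c)) x)
  end.

Definition mu_comp (F : composition I) : tensor_blocks (blocks F) -> h I :=
  mu_seq (valP F).

Definition Delta_comp (F : composition I) : h I -> tensor_blocks (blocks F) :=
  Delta_seq (valP F).

(* 𝚺[I], on the basis of all compositions of I *)
Definition Sigma : lmodType k := {ffun composition I -> k^o}.

Definition Hbasis (F : composition I) : Sigma := [ffun G => (G == F)%:R].

Definition Qbasis (F : composition I) : Sigma :=
  \sum_(G | comp_le F G)
    ((-1) ^+ (size (blocks G) - size (blocks F)) / (rel_length G F)%:R) *: Hbasis G.

Definition GR_idempotent (X : set_partition I) : Sigma :=
  ((#|val X|)`!)%:R^-1 *: \sum_(F | supp F == val X) Qbasis F.

Definition Psi (z : Sigma) : h I -> h I :=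
  fun x => \sum_F (z : {ffun composition I -> k^o}) F *: mu_comp (Delta_comp F x).

Lemma mu_in_linear (A S T : {set I}) (d : decomp A S T) : linear (mu_in (h := h) d).
Proof.
by move=> c x y; rewrite /mu_in tmap_linear ?linearP //; apply: linearP.
Qed.

Lemma Delta_in_linear (A S T : {set I}) (d : decomp A S T) :
  linear (Delta_in (h := h) d).
Proof.
by move=> c x y; rewrite /Delta_in linearP tmap_linear //; apply: linearP.
Qed.

Lemma mu_seq_linear (s : seq {set I}) (c : is_composition s) :
  linear (mu_seq c).
Proof.
case: s c => [|B s] c /=.
  by move=> a x y; rewrite !linearP.
move: (composition_disjoint c) (composition_union c) => d u a x y.
rewrite -linearP; congr (sp_map _ _ _).
elim: s B d {c u} a x y => [|C s IHs] B d a x y //=.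
by rewrite tmap_linear ?mu_in_linear // => a' x' y'; apply: IHs.
Qed.

Lemma Delta_seq_linear (s : seq {set I}) (c : is_composition s) :
  linear (Delta_seq c).
Proof.
case: s c => [|B s] c /=.
  by move=> a x y; rewrite !linearP.
move: (composition_disjoint c) (composition_union c) => d u a x y.
rewrite linearP; move: (sp_map _ _ x) (sp_map _ _ y) => {u}.
elim: s B d {c x y} a => [|C s IHs] B d a x y //=.
rewrite Delta_in_linear tmap_linear // => a' x' y'; apply: IHs.
Qed.

Lemma Psi_linear z : linear (Psi z).
Proof.
move=> c x y; rewrite /Psi scaler_sumr -big_split; apply: eq_bigr => F _ /=.
by rewrite /Delta_comp Delta_seq_linear /mu_comp mu_seq_linear scalerDr !scalerA mulrC.
Qed.

(* h(X), the blocks of X being listed in an arbitrary order *)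
Definition h_part (X : set_partition I) : lmodType k :=
  tensor_blocks (enum (val X)).

Definition kX (X : set_partition I) : int :=
  \sum_(Y | part_le X Y)
    moebius (@part_le I) X Y * (dimension (fullspace (h_part Y)))%:Z.

End Psi.

Arguments Psi {k} h {I} z _.

(* Main.v *)
From HB Require Import structures.
Require Import Defs.
From mathcomp Require Import all_boot all_order all_algebra.
From mathcomp Require Import sesquilinear boolp zify.

Set Implicit Arguments.
Unset Strict Implicit.
Unset Printing Implicit Defensive.

Import GRing.Theory.
Local Open Scope ring_scope.

(* For endomorphisms f of h[S] and g of h[T], put f * g = mu_{S,T} (f ⊗ g) Delta_{S,T};
   this is associative, and mu_F Delta_F = id_{I_1} * ... * id_{I_k}. Since h is
   cocommutative, a convolution product of families of endomorphisms commuting with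
   the coproduct commutes with it again; so restricting the factors of t to the
   blocks of s computes the composite of the products indexed by s and t.

   Let e = log(id) in the convolution algebra. The convolution power id^{*n} commutes
   with the coproduct and is polynomial in n, without constant term on nonempty sets;
   e is its linear coefficient, so Delta_{S,T} e = 0 for S, T nonempty. Moreover
   Psi(Q_F) = e_{I_1} * ... * e_{I_k}. Primitivity of e gives
   Psi(E_X) Psi(E_Y) = 0 unless X <= Y, and Psi(E_X)^2 = Psi(E_X); the identity
   exp(log(id)) = id gives that the Psi(E_X) add up to the identity, which forces
   the remaining products Psi(E_X) Psi(E_Y), X < Y, to vanish.

   For the dimensions, the idempotent p = mu_F Delta_F with supp F = Y has image
   isomorphic to h(Y), and p Psi(E_X) = 0 unless Y <= X, in which case
   Psi(E_X) p = Psi(E_X). Taking traces, dim h(Y) is the sum of the ranks of the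
   Psi(E_X) for X >= Y; Moebius inversion concludes. *)

(** * Linear maps and tensor products *)

Section LinearMaps.
Variables (k : fieldType) (V W : lmodType k).

(** Bundling makes linear maps the vectors of a space of their own, so that sums, scalings and
    equalities are taken between operators rather than pointwise. *)
Record lmap := Lmap { lfun :> V -> W; lmapP : linear lfun }.

HB.instance Definition _ := gen_eqMixin lmap.
HB.instance Definition _ := gen_choiceMixin lmap.
HB.instance Definition _ (f : lmap) := GRing.isLinear.Build k V W *:%R f (lmapP f).

Lemma lmap_eq (f g : lmap) : f =1 g -> f = g.
Proof.
case: f g => [f lf] [g lg] /= /funext fg; subst g.
by congr Lmap; apply: Prop_irrelevance.
Qed.

Definition lmap_of (f : {linear V -> W}) : lmap := Lmap (@linearP _ _ _ _ f).

Lemma lmap_add_subproof (f g : lmap) : linear (fun x => f x + g x).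
Proof. by move=> c x y; rewrite !linearP scalerDr addrACA. Qed.
Lemma lmap_opp_subproof (f : lmap) : linear (fun x => - f x).
Proof. by move=> c x y; rewrite linearP opprD scalerN. Qed.
Lemma lmap_zero_subproof : linear (fun x : V => 0 : W).
Proof. by move=> c x y; rewrite scaler0 addr0. Qed.
Lemma lmap_scale_subproof (a : k) (f : lmap) : linear (fun x => a *: f x).
Proof. by move=> c x y; rewrite linearP scalerDr !scalerA mulrC. Qed.

Definition lmap_add f g := Lmap (lmap_add_subproof f g).
Definition lmap_opp f := Lmap (lmap_opp_subproof f).
Definition lmap_zero := Lmap lmap_zero_subproof.
Definition lmap_scale a f := Lmap (lmap_scale_subproof a f).

Let addA : associative lmap_add.
Proof. by move=> f g e; apply: lmap_eq => x /=; rewrite addrA. Qed.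
Let addC : commutative lmap_add.
Proof. by move=> f g; apply: lmap_eq => x /=; rewrite addrC. Qed.
Let add0 : left_id lmap_zero lmap_add.
Proof. by move=> f; apply: lmap_eq => x /=; rewrite add0r. Qed.
Let addN : left_inverse lmap_zero lmap_opp lmap_add.
Proof. by move=> f; apply: lmap_eq => x /=; rewrite addNr. Qed.
HB.instance Definition _ := GRing.isZmodule.Build lmap addA addC add0 addN.

Let scaleA a b f : lmap_scale a (lmap_scale b f) = lmap_scale (a * b) f.
Proof. by apply: lmap_eq => x /=; rewrite scalerA. Qed.
Let scale1 : left_id 1 lmap_scale.
Proof. by move=> f; apply: lmap_eq => x /=; rewrite scale1r. Qed.
Let scaleDr : right_distributive lmap_scale +%R.
Proof. by move=> a f g; apply: lmap_eq => x /=; rewrite scalerDr. Qed.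
Let scaleDl f : {morph lmap_scale^~ f : a b / a + b}.
Proof. by move=> a b; apply: lmap_eq => x /=; rewrite scalerDl. Qed.
HB.instance Definition _ := GRing.Zmodule_isLmodule.Build k lmap
  scaleA scale1 scaleDr scaleDl.

Lemma laddE (f g : lmap) x : (f + g) x = f x + g x. Proof. by []. Qed.
Lemma lzeroE x : (0 : lmap) x = 0. Proof. by []. Qed.
Lemma lscaleE (a : k) (f : lmap) x : (a *: f) x = a *: f x. Proof. by []. Qed.
Lemma lsumE (J : Type) (r : seq J) (P : pred J) (F : J -> lmap) x :
  (\sum_(j <- r | P j) F j) x = \sum_(j <- r | P j) F j x.
Proof. exact: (big_morph (fun f : lmap => f x) (fun f g => erefl) erefl). Qed.

End LinearMaps.

Definition lid (k : fieldType) (V : lmodType k) : lmap V V :=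
  Lmap (fun (c : k) (x y : V) => erefl (c *: x + y)).

Section Composition.
Variable k : fieldType.
Implicit Types V W X Y Z : lmodType k.

Lemma lcomp_subproof V W X (f : lmap W X) (g : lmap V W) :
  linear (fun x => f (g x)).
Proof. by move=> c x y; rewrite !linearP. Qed.

Definition lcomp V W X (f : lmap W X) (g : lmap V W) : lmap V X :=
  Lmap (lcomp_subproof f g).

Definition ltensor V V' W W' (f : lmap V V') (g : lmap W W') :
    lmap (V ⊗ W) (V' ⊗ W') := Lmap (tmap_linear (lmapP f) (lmapP g)).

End Composition.

Notation "f ∘ g" := (lcomp f g) (at level 40, left associativity).
Notation "f ⊠ g" := (ltensor f g) (at level 35, no associativity).

Section CompositionTheory.
Variable k : fieldType.
Implicit Types V W X Y Z : lmodType k.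

Lemma lcompE V W X (f : lmap W X) (g : lmap V W) x : (f ∘ g) x = f (g x).
Proof. by []. Qed.

Lemma lcompA V W X Y (f : lmap X Y) (g : lmap W X) (e : lmap V W) :
  f ∘ (g ∘ e) = f ∘ g ∘ e.
Proof. exact: lmap_eq. Qed.

Lemma lcomp1l V W (f : lmap V W) : lid W ∘ f = f.
Proof. exact: lmap_eq. Qed.

Lemma lcomp1r V W (f : lmap V W) : f ∘ lid V = f.
Proof. exact: lmap_eq. Qed.

Lemma lcomp_linearl V W X (g : lmap V W) : linear (fun f : lmap W X => f ∘ g).
Proof. by move=> c f f'; apply: lmap_eq. Qed.

Lemma lcomp_linearr V W X (f : lmap W X) : linear (fun g : lmap V W => f ∘ g).
Proof. by move=> c g g'; apply: lmap_eq => x /=; rewrite linearP. Qed.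

Lemma lcomp_sumZl V W X (J : Type) (r : seq J) (P : pred J) (c : J -> k)
    (F : J -> lmap W X) (g : lmap V W) :
  (\sum_(j <- r | P j) c j *: F j) ∘ g = \sum_(j <- r | P j) c j *: (F j ∘ g).
Proof.
by apply: lmap_eq => x; rewrite lcompE !lsumE; apply: eq_bigr.
Qed.

Lemma lcomp_suml V W X (J : Type) (r : seq J) (P : pred J)
    (F : J -> lmap W X) (g : lmap V W) :
  (\sum_(j <- r | P j) F j) ∘ g = \sum_(j <- r | P j) (F j ∘ g).
Proof.
by apply: lmap_eq => x; rewrite lcompE !lsumE; apply: eq_bigr.
Qed.

Lemma lcomp_sumr V W X (J : Type) (r : seq J) (P : pred J)
    (f : lmap W X) (G : J -> lmap V W) :
  f ∘ (\sum_(j <- r | P j) G j) = \sum_(j <- r | P j) (f ∘ G j).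
Proof.
apply: lmap_eq => x; rewrite lcompE !lsumE linear_sum.
by apply: eq_bigr => j _.
Qed.

Lemma lcompZl V W X (c : k) (f : lmap W X) (g : lmap V W) :
  (c *: f) ∘ g = c *: (f ∘ g).
Proof. exact: lmap_eq. Qed.

Lemma lcompZr V W X (c : k) (f : lmap W X) (g : lmap V W) :
  f ∘ (c *: g) = c *: (f ∘ g).
Proof. by apply: lmap_eq => x /=; rewrite linearZ. Qed.

Lemma lcomp0l V W X (g : lmap V W) : (0 : lmap W X) ∘ g = 0.
Proof. exact: lmap_eq. Qed.

Lemma lcomp0r V W X (f : lmap W X) : f ∘ (0 : lmap V W) = 0.
Proof. by apply: lmap_eq => x /=; rewrite linear0. Qed.

Lemma tensor_ext V W X (f g : lmap (V ⊗ W) X) :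
  (forall v w, f (tpure v w) = g (tpure v w)) -> f = g.
Proof. by move=> fg; apply/lmap_eq/tlift_unique. Qed.

Lemma ltensor_pure V V' W W' (f : lmap V V') (g : lmap W W') v w :
  (f ⊠ g) (tpure v w) = tpure (f v) (g w).
Proof. exact: tmap_pure (lmapP f) (lmapP g). Qed.

Lemma ltensor_comp V V' V'' W W' W'' (f' : lmap V' V'') (f : lmap V V')
    (g' : lmap W' W'') (g : lmap W W') :
  (f' ⊠ g') ∘ (f ⊠ g) = (f' ∘ f) ⊠ (g' ∘ g).
Proof. by apply: tensor_ext => v w; rewrite lcompE !ltensor_pure. Qed.

Lemma ltensor_id V W : lid V ⊠ lid W = lid (V ⊗ W).
Proof. by apply: tensor_ext => v w; rewrite ltensor_pure. Qed.

Lemma tpureDl V W (v v' : V) (w : W) : tpure (v + v') w = tpure v w + tpure v' w.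
Proof. by have := (tpure_bilinear V W).1 w 1 v v'; rewrite /= !scale1r. Qed.
Lemma tpureDr V W (v : V) (w w' : W) : tpure v (w + w') = tpure v w + tpure v w'.
Proof. by have := (tpure_bilinear V W).2 v 1 w w'; rewrite /= !scale1r. Qed.
Lemma tpure0l V W (w : W) : tpure (0 : V) w = 0.
Proof. by apply: (addrI (tpure 0 w)); rewrite -tpureDl !addr0. Qed.
Lemma tpure0r V W (v : V) : tpure v (0 : W) = 0.
Proof. by apply: (addrI (tpure v 0)); rewrite -tpureDr !addr0. Qed.
Lemma tpureZl V W (c : k) (v : V) (w : W) : tpure (c *: v) w = c *: tpure v w.
Proof. by have := (tpure_bilinear V W).1 w c v 0; rewrite /= tpure0l !addr0. Qed.
Lemma tpureZr V W (c : k) (v : V) (w : W) : tpure v (c *: w) = c *: tpure v w.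
Proof. by have := (tpure_bilinear V W).2 v c w 0; rewrite /= tpure0r !addr0. Qed.

Lemma ltensor_linearl V V' W W' (g : lmap W W') :
  linear (fun f : lmap V V' => f ⊠ g).
Proof.
move=> c f f'; apply: tensor_ext => v w.
by rewrite laddE lscaleE !ltensor_pure laddE lscaleE tpureDl tpureZl.
Qed.

Lemma ltensor_linearr V V' W W' (f : lmap V V') :
  linear (fun g : lmap W W' => f ⊠ g).
Proof.
move=> c g g'; apply: tensor_ext => v w.
by rewrite laddE lscaleE !ltensor_pure laddE lscaleE tpureDr tpureZr.
Qed.

Lemma ltensor0l V V' W W' (g : lmap W W') : (0 : lmap V V') ⊠ g = 0.
Proof. by apply: tensor_ext => v w; rewrite ltensor_pure lzeroE tpure0l. Qed.

Lemma ltensor0r V V' W W' (f : lmap V V') : f ⊠ (0 : lmap W W') = 0.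
Proof. by apply: tensor_ext => v w; rewrite ltensor_pure lzeroE tpure0r. Qed.

Lemma ltensorZl V V' W W' (c : k) (f : lmap V V') (g : lmap W W') :
  (c *: f) ⊠ g = c *: (f ⊠ g).
Proof.
by apply: tensor_ext => v w; rewrite lscaleE !ltensor_pure lscaleE tpureZl.
Qed.

Lemma ltensorZr V V' W W' (c : k) (f : lmap V V') (g : lmap W W') :
  f ⊠ (c *: g) = c *: (f ⊠ g).
Proof.
by apply: tensor_ext => v w; rewrite lscaleE !ltensor_pure lscaleE tpureZr.
Qed.

Lemma ltensor_suml V V' W W' (J : Type) (r : seq J) (P : pred J)
    (F : J -> lmap V V') (g : lmap W W') :
  (\sum_(j <- r | P j) F j) ⊠ g = \sum_(j <- r | P j) (F j ⊠ g).
Proof.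
apply: (big_morph (fun f : lmap V V' => f ⊠ g)); last exact: ltensor0l.
by move=> f f'; have := ltensor_linearl g 1 f f'; rewrite /= !scale1r.
Qed.

Lemma ltensor_sumr V V' W W' (J : Type) (r : seq J) (P : pred J)
    (f : lmap V V') (G : J -> lmap W W') :
  f ⊠ (\sum_(j <- r | P j) G j) = \sum_(j <- r | P j) (f ⊠ G j).
Proof.
apply: (big_morph (fun g : lmap W W' => f ⊠ g)); last exact: ltensor0r.
by move=> g g'; have := ltensor_linearr f 1 g g'; rewrite /= !scale1r.
Qed.

Definition lassoc V W X : lmap ((V ⊗ W) ⊗ X) (V ⊗ (W ⊗ X)) :=
  Lmap (tlift_linear (tassoc_bilinear V W X)).
Definition lswap V W : lmap (V ⊗ W) (W ⊗ V) :=
  Lmap (tlift_linear (tswap_bilinear V W)).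
Definition linterchange V W X Y : lmap ((V ⊗ W) ⊗ (X ⊗ Y)) ((V ⊗ X) ⊗ (W ⊗ Y)) :=
  Lmap (tlift_linear (tinterchange_bilinear V W X Y)).

Lemma lassoc_pure V W X (v : V) (w : W) (x : X) :
  lassoc V W X (tpure (tpure v w) x) = tpure v (tpure w x).
Proof. exact: tassoc_pure. Qed.
Lemma lswap_pure V W (v : V) (w : W) : lswap V W (tpure v w) = tpure w v.
Proof. exact: tswap_pure. Qed.
Lemma linterchange_pure V W X Y (v : V) (w : W) (x : X) (y : Y) :
  linterchange V W X Y (tpure (tpure v w) (tpure x y)) =
  tpure (tpure v x) (tpure w y).
Proof. exact: tinterchange_pure. Qed.

Lemma tensor_ext3 V W X Y (f g : lmap ((V ⊗ W) ⊗ X) Y) :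
  (forall v w x, f (tpure (tpure v w) x) = g (tpure (tpure v w) x)) -> f = g.
Proof.
move=> fg; apply: tensor_ext => t x.
pose pr : lmap (V ⊗ W) ((V ⊗ W) ⊗ X) :=
  Lmap ((tpure_bilinear (V ⊗ W) X).1 x).
suff -> : f (tpure t x) = (f ∘ pr) t.
  suff -> : f ∘ pr = g ∘ pr by [].
  by apply: tensor_ext => v w; apply: fg.
by [].
Qed.

Lemma tensor_ext4 V W X Y Z (f g : lmap ((V ⊗ W) ⊗ (X ⊗ Y)) Z) :
  (forall v w x y, f (tpure (tpure v w) (tpure x y)) =
                   g (tpure (tpure v w) (tpure x y))) -> f = g.
Proof.
move=> fg; apply: tensor_ext3 => v w t.
pose pr : lmap (X ⊗ Y) ((V ⊗ W) ⊗ (X ⊗ Y)) :=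
  Lmap ((tpure_bilinear (V ⊗ W) (X ⊗ Y)).2 (tpure v w)).
suff -> : f (tpure (tpure v w) t) = (f ∘ pr) t.
  suff -> : f ∘ pr = g ∘ pr by [].
  by apply: tensor_ext => x y; apply: fg.
by [].
Qed.

Lemma lassoc_natural V V' W W' X X' (f : lmap V V') (g : lmap W W') (e : lmap X X') :
  lassoc V' W' X' ∘ ((f ⊠ g) ⊠ e) = (f ⊠ (g ⊠ e)) ∘ lassoc V W X.
Proof.
apply: tensor_ext3 => v w x.
by rewrite !lcompE !ltensor_pure !lassoc_pure !ltensor_pure.
Qed.

Lemma linterchange_natural V V' W W' X X' Y Y' (f : lmap V V') (g : lmap W W')
    (e : lmap X X') (d : lmap Y Y') :
  linterchange V' W' X' Y' ∘ ((f ⊠ g) ⊠ (e ⊠ d)) =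
  ((f ⊠ e) ⊠ (g ⊠ d)) ∘ linterchange V W X Y.
Proof.
apply: tensor_ext4 => v w x y.
by rewrite !lcompE !ltensor_pure !linterchange_pure !ltensor_pure.
Qed.

Lemma lassocV_bilinear1 V W X (v : V) : bilinear_for *:%R *:%R
  (fun (w : W) (x : X) => tpure (tpure v w) x).
Proof.
split=> [x c w w' | w c x x']; last by rewrite tpureDr tpureZr.
by rewrite tpureDr tpureZr tpureDl tpureZl.
Qed.

Lemma lassocV_bilinear V W X : bilinear_for *:%R *:%R
  (fun (v : V) (t : W ⊗ X) => tlift (fun w x => tpure (tpure v w) x) t).
Proof.
split=> [t | v]; last exact/tlift_linear/lassocV_bilinear1.
apply: (tlift_param (b := fun v w x => tpure (tpure v w) x)).
  exact: lassocV_bilinear1.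
by move=> w x c v v'; rewrite tpureDl tpureZl tpureDl tpureZl.
Qed.

Definition lassocV V W X : lmap (V ⊗ (W ⊗ X)) ((V ⊗ W) ⊗ X) :=
  Lmap (tlift_linear (lassocV_bilinear V W X)).

Lemma lassocV_pure V W X (v : V) (w : W) (x : X) :
  lassocV V W X (tpure v (tpure w x)) = tpure (tpure v w) x.
Proof.
rewrite /lassocV /= tlift_pure; last exact: lassocV_bilinear.
by rewrite tlift_pure //; apply: lassocV_bilinear1.
Qed.

Lemma lassocK V W X : lassocV V W X ∘ lassoc V W X = lid _.
Proof.
by apply: tensor_ext3 => v w x; rewrite lcompE lassoc_pure lassocV_pure.
Qed.

(** After reassociation the interchange is a single swap of the two middle factors, the one place
    where cocommutativity has to act. *)
Lemma linterchangeE V W X Y :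
  lassoc V X (W ⊗ Y) ∘ linterchange V W X Y =
  (lid V ⊠ (lassoc X W Y ∘ (lswap W X ⊠ lid Y) ∘ lassocV W X Y)) ∘
  lassoc V W (X ⊗ Y).
Proof.
apply: tensor_ext4 => v w x y.
rewrite !lcompE linterchange_pure !lassoc_pure ltensor_pure !lcompE.
by rewrite lassocV_pure ltensor_pure lswap_pure lassoc_pure.
Qed.

End CompositionTheory.

(** * Convolution of endomorphisms *)

Section Decomp.
Variable U : finType.
Implicit Types A B S T : {set U}.

(** Relations between decompositions thereby become Boolean identities at each point, settled by
    cases on memberships. *)
Lemma decompP A S T :
  reflect (forall x, ((x \in A) == (x \in S) || (x \in T)) &&
                     ~~ ((x \in S) && (x \in T)))
          (decomp A S T).
Proof.
apply: (iffP andP) => [[/eqP <- dST] x|d].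
  by rewrite inE eqxx /=; apply/andP=> -[xS]; rewrite (disjointFr dST xS).
split; first by apply/eqP/setP=> x; have /andP[/eqP-> _] := d x; rewrite inE.
rewrite -setI_eq0; apply/eqP/setP=> x; rewrite !inE.
by have /andP[_ /negbTE] := d x.
Qed.

Lemma decomp_eq A S T : decomp A S T -> T = A :\: S.
Proof.
move=> /decompP d; apply/setP=> x; move: (d x); rewrite !inE.
by do 3!case: (x \in _).
Qed.

(** Available for every pair of sets, so that [run] and [star] can cut along any [B] without a side
    condition. *)
Lemma decomp_split A B : decomp A (A :&: B) (A :\: B).
Proof. by apply/decompP=> x; rewrite !inE; do 2!case: (x \in _). Qed.

Lemma decomp_subset A B : B \subset A -> decomp A B (A :\: B).
Proof.
move=> /subsetP sBA; apply/decompP=> x; rewrite !inE.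
by move/implyP: (sBA x); do 2!case: (x \in _).
Qed.

Lemma decomp0s A : decomp A set0 A.
Proof. by apply/decompP=> x; rewrite !inE; case: (x \in _). Qed.

Lemma decomps0 A : decomp A A set0.
Proof. by apply/decompP=> x; rewrite !inE; case: (x \in _). Qed.

Lemma decomp_restrict A S T B : decomp A S T -> decomp (A :&: B) (S :&: B) (T :&: B).
Proof.
move=> /decompP d; apply/decompP=> x; move: (d x); rewrite !inE.
by do 4!case: (x \in _).
Qed.

Lemma decomp_diff A S T B : decomp A S T -> decomp (A :\: B) (S :\: B) (T :\: B).
Proof.
move=> /decompP d; apply/decompP=> x; move: (d x); rewrite !inE.
by do 4!case: (x \in _).
Qed.

End Decomp.

Section Convolution.
Variables (k : fieldType) (h : bimonoid k) (U : finType).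
Hypotheses (h_connected : connected h) (h_cocommutative : cocommutative h).
Implicit Types (A B S T : {set U}).

Local Notation H A := (h (sset A)).

Definition mul A S T (d : decomp A S T) : lmap (H S ⊗ H T) (H A) :=
  Lmap (mu_in_linear (h := h) d).
Definition comul A S T (d : decomp A S T) : lmap (H A) (H S ⊗ H T) :=
  Lmap (Delta_in_linear (h := h) d).

Definition conv A S T (d : decomp A S T) (f : lmap (H S) (H S))
    (g : lmap (H T) (H T)) : lmap (H A) (H A) :=
  mul d ∘ (f ⊠ g) ∘ comul d.

Lemma mul_assoc A R S T RS ST (dRS : decomp RS R S) (dRS_T : decomp A RS T)
    (dST : decomp ST S T) (dR_ST : decomp A R ST) :
  mul dRS_T ∘ (mul dRS ⊠ lid _) =
  mul dR_ST ∘ (lid _ ⊠ mul dST) ∘ lassoc _ _ _.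
Proof.
by apply: lmap_eq => x; apply: (monoid_assoc (bimonoid_monoid (bm_laws h))).
Qed.

Lemma comul_assoc A R S T RS ST (dRS : decomp RS R S) (dRS_T : decomp A RS T)
    (dST : decomp ST S T) (dR_ST : decomp A R ST) :
  lassoc _ _ _ ∘ (comul dRS ⊠ lid _) ∘ comul dRS_T =
  (lid _ ⊠ comul dST) ∘ comul dR_ST.
Proof.
by apply: lmap_eq => x; apply: (comonoid_coassoc (bimonoid_comonoid (bm_laws h))).
Qed.

Lemma comul_mul A S T S' T' B C D E (dI : decomp A S T) (dI' : decomp A S' T')
    (dS : decomp S B C) (dT : decomp T D E)
    (dS' : decomp S' B D) (dT' : decomp T' C E) :
  comul dI' ∘ mul dI =
  (mul dS' ⊠ mul dT') ∘ linterchange _ _ _ _ ∘ (comul dS ⊠ comul dT).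
Proof. by apply: lmap_eq => x; apply: (bimonoid_mu_Delta (bm_laws h)). Qed.

(** [cocommutative] speaks of decompositions of a whole finite set. It is applied to [sset A], and
    the swap commutes with the renaming of the two parts in [Delta_in]. *)
Lemma comul_swap A S T (d : decomp A S T) (d' : decomp A T S) :
  comul d' = lswap _ _ ∘ comul d.
Proof.
apply: lmap_eq => x; rewrite lcompE /= /Delta_in.
have -> : decomp_rset d' = decompC (decomp_rset d) by apply: bool_irrelevance.
rewrite h_cocommutative.
have -> : decomp_subr d' = decomp_subl d by apply: bool_irrelevance.
have -> : decomp_subl d' = decomp_subr d by apply: bool_irrelevance.
move: (bm_Delta _ _ _) => t.
set f := sp_map _ _; set g := sp_map _ _.
have swapK : (lmap_of f ⊠ lmap_of g) ∘ lswap _ _ =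
             lswap _ _ ∘ (lmap_of g ⊠ lmap_of f).
  apply: tensor_ext => v w.
  by rewrite !lcompE lswap_pure !ltensor_pure lswap_pure.
exact: (congr1 (fun e : lmap _ _ => e t) swapK).
Qed.

Lemma conv_assoc A R S T RS ST (dRS : decomp RS R S) (dRS_T : decomp A RS T)
    (dST : decomp ST S T) (dR_ST : decomp A R ST) f g e :
  conv dRS_T (conv dRS f g) e = conv dR_ST f (conv dST g e).
Proof.
rewrite /conv.
have -> : (mul dRS ∘ (f ⊠ g) ∘ comul dRS) ⊠ e =
    (mul dRS ⊠ lid _) ∘ ((f ⊠ g) ⊠ e) ∘ (comul dRS ⊠ lid _).
  by rewrite !ltensor_comp lcomp1l lcomp1r.
rewrite !lcompA (mul_assoc dRS dRS_T dST dR_ST).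
rewrite -(lcompA _ (lassoc _ _ _)) lassoc_natural !lcompA -(lcompA _ (comul dRS ⊠ _)).
rewrite -(lcompA _ (lassoc _ _ _)) (lcompA (lassoc _ _ _)).
rewrite (comul_assoc dRS dRS_T dST dR_ST) !lcompA.
have -> : f ⊠ (mul dST ∘ (g ⊠ e) ∘ comul dST) =
    (lid _ ⊠ mul dST) ∘ (f ⊠ (g ⊠ e)) ∘ (lid _ ⊠ comul dST).
  by rewrite !ltensor_comp lcomp1l lcomp1r.
by rewrite !lcompA.
Qed.

(* Both sides split A into B, C, D, E; by coassociativity they differ by a swap of
   C and D, which cocommutativity absorbs. *)
Lemma comul_interchange A S T S' T' B C D E (dI : decomp A S T)
    (dI' : decomp A S' T') (dS : decomp S B C) (dT : decomp T D E)
    (dS' : decomp S' B D) (dT' : decomp T' C E) :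
  linterchange _ _ _ _ ∘ (comul dS ⊠ comul dT) ∘ comul dI =
  (comul dS' ⊠ comul dT') ∘ comul dI'.
Proof.
move/decompP: (dI) => pI; move/decompP: (dI') => pI'; move/decompP: (dS) => pS.
move/decompP: (dT) => pT; move/decompP: (dS') => pS'; move/decompP: (dT') => pT'.
pose X := C :|: T; pose Y := C :|: D.
have dX : decomp A B X.
  apply/decompP=> x; move: (pI x) (pI' x) (pS x) (pT x) (pS' x) (pT' x).
  by rewrite !inE; do 9!case: (x \in _).
have dCT : decomp X C T.
  apply/decompP=> x; move: (pI x) (pI' x) (pS x) (pT x) (pS' x) (pT' x).
  by rewrite !inE; do 9!case: (x \in _).
have dDT' : decomp X D T'.
  apply/decompP=> x; move: (pI x) (pI' x) (pS x) (pT x) (pS' x) (pT' x).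
  by rewrite !inE; do 9!case: (x \in _).
have dYE : decomp X Y E.
  apply/decompP=> x; move: (pI x) (pI' x) (pS x) (pT x) (pS' x) (pT' x).
  by rewrite !inE; do 9!case: (x \in _).
have dCD : decomp Y C D.
  apply/decompP=> x; move: (pI x) (pI' x) (pS x) (pT x) (pS' x) (pT' x).
  by rewrite !inE; do 9!case: (x \in _).
have split4 (S0 T0 C0 D0 : {set U}) (dI0 : decomp A S0 T0) (dS0 : decomp S0 B C0)
    (dT0 : decomp T0 D0 E) (dX0 : decomp X C0 T0) :
  lassoc _ _ _ ∘ (comul dS0 ⊠ comul dT0) ∘ comul dI0 =
  (lid _ ⊠ ((lid _ ⊠ comul dT0) ∘ comul dX0)) ∘ comul dX.
  have -> : comul dS0 ⊠ comul dT0 =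
      ((lid _ ⊠ lid _) ⊠ comul dT0) ∘ (comul dS0 ⊠ lid _).
    by rewrite ltensor_comp ltensor_id lcomp1l lcomp1r.
  rewrite lcompA lassoc_natural -!lcompA (lcompA (lassoc _ _ _)).
  by rewrite (comul_assoc dS0 dI0 dX0 dX) !lcompA ltensor_comp lcomp1l.
have := split4 _ _ _ _ dI dS dT dCT.
move=> /(congr1 (lcomp (lid _ ⊠ (lassoc _ _ _ ∘ (lswap _ _ ⊠ lid _) ∘ lassocV _ _ _)))).
rewrite !lcompA -linterchangeE => E1.
suff E2 : lassoc _ _ _ ∘ (linterchange _ _ _ _ ∘ (comul dS ⊠ comul dT) ∘ comul dI) =
     lassoc _ _ _ ∘ ((comul dS' ⊠ comul dT') ∘ comul dI').
  by move: E2 => /(congr1 (lcomp (lassocV _ _ _))); rewrite !lcompA lassocK !lcomp1l.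
rewrite !lcompA E1 (split4 _ _ _ _ dI' dS' dT' dDT') ltensor_comp lcomp1l.
congr (_ ⊠ _ ∘ _).
rewrite -(comul_assoc dCD dYE dT dCT) !lcompA -(lcompA _ (lassocV _ _ _)) lassocK lcomp1r.
rewrite -(lcompA (lassoc _ _ _)) ltensor_comp lcomp1l -(comul_swap dCD (decompC dCD)).
by rewrite (comul_assoc (decompC dCD) dYE dT' dDT').
Qed.

(** The bimonoid axiom rewrites the coproduct of a product, and [comul_interchange] absorbs the
    interchange that it creates. The scalars serve factors that commute with the coproduct up to a
    coefficient, such as the logarithm. *)
Lemma comul_conv A S T S' T' B C D E (dI : decomp A S T)
    (dI' : decomp A S' T') (dS : decomp S B C) (dT : decomp T D E)
    (dS' : decomp S' B D) (dT' : decomp T' C E)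
    (x y : k) f fB fC g gD gE :
  comul dS ∘ f = x *: ((fB ⊠ fC) ∘ comul dS) ->
  comul dT ∘ g = y *: ((gD ⊠ gE) ∘ comul dT) ->
  comul dI' ∘ conv dI f g =
  (x * y) *: ((conv dS' fB gD ⊠ conv dT' fC gE) ∘ comul dI').
Proof.
move=> fE gE'; rewrite /conv !lcompA (comul_mul dI dI' dS dT dS' dT').
rewrite -(lcompA _ (comul dS ⊠ _)) ltensor_comp fE gE'.
have -> : (x *: ((fB ⊠ fC) ∘ comul dS)) ⊠ (y *: ((gD ⊠ gE) ∘ comul dT)) =
   (x * y) *: (((fB ⊠ fC) ⊠ (gD ⊠ gE)) ∘ (comul dS ⊠ comul dT)).
  rewrite ltensor_comp; apply: tensor_ext => v w.
  by rewrite lscaleE !ltensor_pure !lscaleE tpureZl tpureZr scalerA.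
rewrite lcompZr lcompZl; congr (_ *: _).
rewrite !lcompA -(lcompA _ (linterchange _ _ _ _)) linterchange_natural !lcompA.
rewrite -(lcompA _ (linterchange _ _ _ _)) -(lcompA _ _ (comul dI)).
by rewrite (comul_interchange dI dI' dS dT dS' dT') !lcompA !ltensor_comp.
Qed.

Lemma conv_linearl A S T (d : decomp A S T) g : linear (conv d ^~ g).
Proof.
by move=> c f f'; rewrite /conv (ltensor_linearl g) lcomp_linearr lcomp_linearl.
Qed.

Lemma conv_linearr A S T (d : decomp A S T) f : linear (conv d f).
Proof.
by move=> c g g'; rewrite /conv (ltensor_linearr f) lcomp_linearr lcomp_linearl.
Qed.

HB.instance Definition _ A S T (d : decomp A S T) f :=
  GRing.isLinear.Build k _ _ *:%R (conv d f) (conv_linearr d f).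

(** [conv] with its arguments exchanged, so that linearity in the first one can be declared as an
    instance. *)
Definition convr A S T (d : decomp A S T) g f := conv d f g.
HB.instance Definition _ A S T (d : decomp A S T) g :=
  GRing.isLinear.Build k _ _ *:%R (convr d g) (conv_linearl d g).

Lemma conv0l A S T (d : decomp A S T) g : conv d 0 g = 0.
Proof. exact: linear0 (convr d g). Qed.

Lemma conv_suml A S T (d : decomp A S T) g (J : Type) (r : seq J) P F :
  conv d (\sum_(j <- r | P j) F j) g = \sum_(j <- r | P j) conv d (F j) g.
Proof. exact: linear_sum (convr d g) _ _ _ _. Qed.

Lemma convZl A S T (d : decomp A S T) g c f : conv d (c *: f) g = c *: conv d f g.
Proof. exact: linearZ_LR (convr d g) _ _. Qed.

Definition unitv : H (set0 : {set U}) := iota_in h U 1.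


(** By connectedness [x] and the unit are multiples of one vector; the counit, being 1 on the unit,
    determines the factor. *)
Lemma H0_unit (x : H (set0 : {set U})) : x = eps_in x *: unitv.
Proof.
have [b [_ bP]] := h_connected.
have scal y : exists c, y = c *: b ord0.
  by have [c [yE _]] := bP y Logic.I; exists (c ord0); rewrite yE big_ord1.
have voidE (y : h void) : y = bm_eps h y *: bm_iota h 1.
  have [c yE] := scal y; have [d iE] := scal (bm_iota h 1).
  have := bimonoid_iota_eps (bm_laws h).
  rewrite /iota_eps_compat iE yE !linearZ /=; set e := bm_eps _ _ => ieps.
  by rewrite scalerA -[c *: e]/(c * e) mulrCA -[d * e]/(d *: e) ieps mulr1.
rewrite /unitv /eps_in /iota_in -linearZ /= -voidE.
have bid : bijective (@of_void (sset (set0 : {set U})) \o @to_void U).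
  exact: bij_comp (of_void_bij (erefl set0)) (@to_void_bij U).
rewrite -(sp_map_comp _ _ bid).
have idE : @of_void (sset (set0 : {set U})) \o @to_void U = id.
  by apply/funext=> y; case: (to_void_subproof y).
by move: bid; rewrite idE => bid; rewrite sp_map_id.
Qed.

End Convolution.

(** * Families of endomorphisms and their products along lists of blocks *)

Section Families.
Variables (k : fieldType) (h : bimonoid k) (U : finType).
Hypotheses (h_connected : connected h) (h_cocommutative : cocommutative h).
Implicit Types (A B C S T : {set U}) (s t g : seq {set U}).

Local Notation H A := (h (sset A)).
Local Notation H0 := (h (sset (set0 : {set U}))).

Lemma mul_unitr A (d : decomp A A set0) (x : H A) : mul h d (tpure x (unitv h U)) = x.
Proof.
exact: (monoid_unit (bimonoid_monoid (bm_laws h)) (decomp0s A) d x).2.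
Qed.

Lemma mul_unitl A (d : decomp A set0 A) (x : H A) : mul h d (tpure (unitv h U) x) = x.
Proof.
exact: (monoid_unit (bimonoid_monoid (bm_laws h)) d (decomps0 A) x).1.
Qed.

Lemma eps_in_linear : linear (eps_in (h := h) (U := U) : _ -> k^o).
Proof. by move=> c x y; rewrite /eps_in !linearP. Qed.

(** The counit law says that [f], the counit on the right factor, sends the coproduct of [x] to [x];
    by [H0_unit], tensoring with the unit undoes [f]. *)
Lemma comul_unitr A (d : decomp A A set0) (x : H A) :
  comul h d x = tpure x (unitv h U).
Proof.
have bil : bilinear_for *:%R *:%R (fun (y : H A) (z : H0) => eps_in z *: y).
  split=> [z c y y' | y c z z']; first by rewrite /= scalerDr !scalerA mulrC.
  have E : eps_in (c *: z + z') = c * eps_in z + eps_in z' := eps_in_linear c z z'.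
  by rewrite /= E scalerDl scalerA.
pose f := Lmap (tlift_linear bil).
pose g : lmap (H A) (H A ⊗ H0) :=
  Lmap ((tpure_bilinear (H A) H0).1 (unitv h U)).
have fK : g ∘ f = lid _.
  apply: tensor_ext => y z; rewrite lcompE /= tlift_pure // [z in RHS]H0_unit //.
  by rewrite tpureZl tpureZr.
have fE : f (comul h d x) = x.
  exact: (comonoid_counit (bimonoid_comonoid (bm_laws h)) (decomp0s A) d x).2.
by rewrite -[LHS]/(lid _ _) -fK lcompE fE.
Qed.

Lemma comul_unitl A (d : decomp A set0 A) (x : H A) :
  comul h d x = tpure (unitv h U) x.
Proof.
by rewrite (comul_swap h_cocommutative (decomps0 A)) lcompE comul_unitr lswap_pure.
Qed.

Definition family := forall A : {set U}, lmap (H A) (H A).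

Definition idfam : family := fun A => lid (H A).

Implicit Types a b : family.

(** The type of [conv] depends on the parts, so rewriting one of them alone would be ill-typed; here
    the parts change together with the values of the families. *)
Lemma conv_eq a b A S T S' T' (d : decomp A S T) (d' : decomp A S' T') :
  S = S' -> T = T' -> conv d (a S) (b T) = conv d' (a S') (b T').
Proof. by move=> eS eT; subst S' T'; rewrite (bool_irrelevance d d'). Qed.

Lemma conv_unitr a b A S T (d : decomp A S T) :
  b set0 = lid _ -> T = set0 -> conv d (a S) (b T) = a A.
Proof.
move=> b0 T0; subst T.
have SA : S = A by rewrite (decomp_eq (decompC d)) setD0.
subst S; rewrite b0; apply: lmap_eq => x.
by rewrite /conv !lcompE comul_unitr ltensor_pure mul_unitr.
Qed.

Lemma conv_unitl a b A S T (d : decomp A S T) :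
  a set0 = lid _ -> S = set0 -> conv d (a S) (b T) = b A.
Proof.
move=> a0 S0; subst S.
have TA : T = A by rewrite (decomp_eq d) setD0.
subst T; rewrite a0; apply: lmap_eq => x.
by rewrite /conv !lcompE comul_unitl ltensor_pure mul_unitl.
Qed.

(* Blocks are intersected with what their predecessors left of A, and what
   remains after the last one is a further block carrying the identity. *)
Fixpoint run a s A : lmap (H A) (H A) :=
  if s is B :: s' then conv (decomp_split A B) (a (A :&: B)) (run a s' (A :\: B))
  else lid (H A).

(** Weight 1 describes families commuting with the coproduct, [primitive_weight] families with
    primitive values on nonempty sets: one notion serves the identity and the logarithm. *)
Definition comonoidal (w : {set U} -> {set U} -> k) a : Prop :=
  forall A S T (d : decomp A S T),
    comul h d ∘ a A = w S T *: ((a S ⊠ a T) ∘ comul h d).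

Fixpoint run_weight (w : {set U} -> {set U} -> k) s S T : k :=
  if s is B :: s' then w (S :&: B) (T :&: B) * run_weight w s' (S :\: B) (T :\: B)
  else 1.

(** Cutting by [B] restricts a decomposition of [A] to [A :&: B] and to [A :\: B]; [comul_conv] then
    multiplies the weight of the first block by that of the rest. *)
Lemma run_comonoidal w a s : comonoidal w a -> comonoidal (run_weight w s) (run a s).
Proof.
move=> wa; elim: s => [|B s IHs] A S T d /=.
  by rewrite scale1r ltensor_id lcomp1l lcomp1r.
exact: (comul_conv h_cocommutative (decomp_split A B) d (decomp_split S B)
  (decomp_split T B) (wa _ _ _ (decomp_restrict B d)) (IHs _ _ _ (decomp_diff B d))).
Qed.

(** The basic composition rule: a comonoidal family passes through the coproduct inside [conv] and
    acts on each part separately. *)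
Lemma conv_comp w b A S T (d : decomp A S T) f f' : comonoidal w b ->
  conv d f f' ∘ b A = w S T *: conv d (f ∘ b S) (f' ∘ b T).
Proof.
by move=> wb; rewrite /conv -!lcompA wb lcompZr lcompZr (lcompA (f ⊠ f')) ltensor_comp.
Qed.

Lemma run_weight1 s S T : run_weight (fun _ _ => 1) s S T = 1.
Proof. by elim: s S T => [|B s IHs] S T //=; rewrite mul1r. Qed.

Lemma idfam_comonoidal : comonoidal (fun _ _ => 1) idfam.
Proof. by move=> A S T d; rewrite scale1r ltensor_id lcomp1l lcomp1r. Qed.

Lemma run_id s A : {in s, forall B, A \subset B \/ A :&: B = set0} ->
  run idfam s A = lid _.
Proof.
elim: s A => [|B s IHs] A sA //=.
have run0 : run idfam s set0 = lid _ by apply: IHs => C _; left; apply: sub0set.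
have [/setIidPl AB|AB] := sA B (mem_head _ _).
  by apply: conv_unitr => //; rewrite -AB setDIl setDv setI0.
rewrite conv_unitl //; apply: IHs => C Cs; apply: sA.
by rewrite inE Cs orbT.
Qed.

Lemma run_disjoint a s A : a set0 = lid _ ->
  {in s, forall B, A :&: B = set0} -> run a s A = lid _.
Proof.
move=> a0; elim: s A => [|B s IHs] A sA //=.
rewrite conv_unitl ?sA ?mem_head //; apply: IHs => C Cs; apply: sA.
by rewrite inE Cs orbT.
Qed.

Lemma pairwise_disjointP s B C : pairwise_disjoint s -> B \in s -> C \in s ->
  B = C \/ B :&: C = set0.
Proof.
elim: s => [|D s IHs] //= /andP[/allP Ds ds]; rewrite !inE.
case/predU1P=> [->|Bs] /predU1P[->|Cs].
- by left.
- by right; apply/disjoint_setI0/Ds.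
- by right; rewrite setIC; apply/disjoint_setI0/Ds.
- exact: IHs.
Qed.

(** The other blocks meet [A] in the empty set, where [a] is the identity and hence neutral for
    convolution. *)
Lemma run_block a s A : a set0 = lid _ -> pairwise_disjoint s -> A \in s ->
  run a s A = a A.
Proof.
move=> a0; elim: s A => [|B s IHs] A //= /andP[/allP Bs ds].
rewrite inE => /predU1P[->|As].
  rewrite conv_unitr ?setDv //; apply: run_disjoint => // C _.
  by rewrite set0I.
by rewrite conv_unitl ?IHs // setIC; apply/disjoint_setI0/Bs.
Qed.

Definition primitive_weight S T : k := ((S == set0) || (T == set0))%:R.

(** The blocks before [C] are disjoint from it and leave its intersections with [S] and [T] intact;
    when [C] is reached, its factor is 0. *)
Lemma run_weight0 s C S T : pairwise_disjoint s -> C \in s ->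
  C :&: S != set0 -> C :&: T != set0 -> run_weight primitive_weight s S T = 0.
Proof.
elim: s S T => [|B s IHs] S T //= /andP[/allP Bs ds].
rewrite inE => /predU1P[->|Cs] CS CT.
  by rewrite /primitive_weight setIC (negbTE CS) setIC (negbTE CT) mul0r.
have dis X : C :&: (X :\: B) = C :&: X.
  apply/setP=> x; rewrite !inE; case xC: (x \in C) => //=.
  by rewrite (disjointFl (Bs C Cs) xC).
by rewrite IHs ?mulr0 ?dis.
Qed.

Lemma run_weight_prim1 s S T :
  {in s, forall C, C :&: S = set0 \/ C :&: T = set0} ->
  run_weight primitive_weight s S T = 1.
Proof.
elim: s S T => [|B s IHs] S T sST //=; rewrite IHs ?mulr1.
  by rewrite /primitive_weight !(setIC _ B); case: (sST B (mem_head _ _)) => ->;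
    rewrite eqxx ?orbT.
move=> C Cs; rewrite !setIDA; case: (sST C); rewrite ?inE ?Cs ?orbT //.
  by move=> ->; left; rewrite set0D.
by move=> ->; right; rewrite set0D.
Qed.

(** The blocks of [s] cover [C :&: A] but none contains it, so the first one that meets it cuts it
    into two nonempty parts, and there the weight of [run b t] vanishes. *)
Lemma run_comp_eq0 a b s t A C : comonoidal primitive_weight b ->
  pairwise_disjoint t -> C \in t -> C :&: A != set0 ->
  C :&: A \subset \bigcup_(B <- s) B -> {in s, forall B, ~~ (C :&: A \subset B)} ->
  run a s A ∘ run b t A = 0.
Proof.
move=> wb dt Ct; elim: s A => [|B s IHs] A CA0 /=.
  by rewrite big_nil subset0 (negbTE CA0).
rewrite big_cons => sub nsub.
rewrite (conv_comp _ _ _ (run_comonoidal t wb)).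
have CAB : C :&: (A :\: B) != set0.
  by rewrite setIDA setD_eq0 nsub ?mem_head.
have [CB|CB] := eqVneq (C :&: (A :&: B)) set0; last first.
  by rewrite (run_weight0 (C := C)) ?scale0r.
(* A block [B] missing [C :&: A] leaves it whole, and the induction continues in [A :\: B]. *)
have CE : C :&: (A :\: B) = C :&: A.
  apply/setP=> x; move/setP/(_ x): CB; rewrite !inE.
  by do 3!case: (x \in _).
rewrite IHs ?CE ?linear0 ?scaler0 //.
  apply/subsetP=> x xCA; have := subsetP sub x xCA; rewrite inE => /orP[xB|//].
  by move/setP/(_ x): CB; rewrite setIA !inE -in_setI xCA xB.
by move=> D Ds; apply: nsub; rewrite inE Ds orbT.
Qed.

Lemma bigcup_mem s B : B \in s -> B \subset \bigcup_(C <- s) C.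
Proof. by move=> Bs; rewrite (big_rem B) //= subsetUl. Qed.

Lemma bigcup_disjoint s B : (forall C, C \in s -> B :&: C = set0) ->
  B :&: \bigcup_(C <- s) C = set0.
Proof.
move=> dis; apply/disjoint_setI0/disjoint_bigcup_seq/allP=> C /dis.
by rewrite -setI_eq0 => ->.
Qed.

(** Blocks of [s] are blocks of [t], so cutting along one of them cuts no block of [t]: all weights
    are 1 and the composite is taken block by block. The list [t] stays fixed while the induction
    shortens [s]. *)
Lemma run_comp_same a b s t : comonoidal primitive_weight b -> b set0 = lid _ ->
  pairwise_disjoint t -> pairwise_disjoint s -> {subset s <= t} ->
  run a s (\bigcup_(B <- s) B) ∘ run b t (\bigcup_(B <- s) B) =
  run (fun A => a A ∘ b A) s (\bigcup_(B <- s) B).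
Proof.
move=> wb b0 dt; elim: s => [|B s IHs] ds st.
  by rewrite big_nil /= lcomp1l run_disjoint // => C _; rewrite set0I.
have [/allP Bs ds'] := andP ds.
have sB : (\bigcup_(C <- B :: s) C) :\: B = \bigcup_(C <- s) C.
  rewrite big_cons setDUl setDv set0U; apply/setDidPl.
  by rewrite disjoint_sym; apply/disjoint_bigcup_seq/allP.
have iB : (\bigcup_(C <- B :: s) C) :&: B = B by rewrite big_cons setUK.
rewrite [run a _ _]/= (conv_comp _ _ _ (run_comonoidal t wb)) run_weight_prim1.
  rewrite scale1r [RHS]/=.
  have fstE X : X = B -> a X ∘ run b t X = a X ∘ b X.
    by move=> ->; rewrite (run_block b0 dt) // st ?mem_head.
  have sndE X : X = \bigcup_(C <- s) C ->
      run a s X ∘ run b t X = run (fun A => a A ∘ b A) s X.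
    by move=> ->; apply: IHs => // C Cs; rewrite st // inE Cs orbT.
  by rewrite (fstE _ iB) (sndE _ sB).
move=> C Ct; rewrite iB sB.
have [->|CB] := pairwise_disjointP dt Ct (st _ (mem_head _ _)).
  by right; apply: bigcup_disjoint => D Ds; apply/disjoint_setI0/Bs.
by left.
Qed.

(** Identities have weight 1, so [run idfam t] restricts to the blocks of [s], where [run_id] makes
    it the identity. *)
Lemma run_absorb a s t A : A \subset \bigcup_(B <- s) B ->
  (forall B C, B \in s -> C \in t -> B \subset C \/ B :&: C = set0) ->
  run a s A ∘ run idfam t A = run a s A.
Proof.
elim: s A => [|B s IHs] A.
  rewrite big_nil subset0 => /eqP -> _ /=; rewrite lcomp1l run_id // => C _.
  by left; apply: sub0set.
rewrite big_cons => AsB sub.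
rewrite [run a _ _]/= (conv_comp _ _ _ (run_comonoidal t idfam_comonoidal)).
rewrite run_weight1 scale1r IHs.
- rewrite run_id ?lcomp1r // => C Ct.
  have [BC|BC] := sub B C (mem_head _ _) Ct.
    by left; apply: subset_trans BC; apply: subsetIr.
  by right; rewrite -setIA BC setI0.
- by rewrite subDset.
- by move=> C D Cs; apply: sub; rewrite inE Cs orbT.
Qed.

(** The two inclusions force [S] to be the part of [A] covered by [g]; the block-by-block cut of [S]
    is then rebracketed by [conv_assoc]. *)
Lemma run_cat a g t A S T (d : decomp A S T) : a set0 = lid _ ->
  S \subset \bigcup_(B <- g) B -> T :&: \bigcup_(B <- g) B = set0 ->
  run a (g ++ t) A = conv d (run a g S) (run a t T).
Proof.
move=> a0; elim: g A S T d => [|B g IHg] A S T d.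
  rewrite big_nil subset0 => /eqP S0 _.
  by rewrite (conv_unitl (a := run a [::])).
rewrite big_cons => Sg Tg; have dd := decompP _ _ _ d.
have dST : decomp (A :\: B) (S :\: B) T.
  apply/decompP=> x; move/setP/(_ x): Tg; move: (dd x); rewrite !inE.
  by do 5!case: (x \in _).
have dA : decomp A (S :&: B) (A :\: B).
  apply/decompP=> x; move/setP/(_ x): Tg; move: (dd x); rewrite !inE.
  by do 5!case: (x \in _).
rewrite [run a (B :: g) S]/= (conv_assoc _ d dST dA) -(IHg _ _ _ dST).
- apply: (conv_eq a (run a (g ++ t))) => //.
  apply/setP=> x; move/setP/(_ x): Tg; move: (dd x); rewrite !inE.
  by do 5!case: (x \in _).
- by rewrite subDset.
- by apply/setP=> x; move/setP/(_ x): Tg; rewrite !inE; do 3!case: (x \in _).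
Qed.

End Families.

(** * Binomial polynomials *)

Section BinomialPolynomials.
Variable k : fieldType.
Hypothesis char0 : [pchar k] =i pred0.

Lemma natr_inj0 : injective (fun n : nat => n%:R : k).
Proof.
move=> m n; wlog mn : m n / (m <= n)%N => [hw|].
  by case: (leqP m n) => [|/ltnW] mn eq; [|apply/esym]; apply: hw.
rewrite -(subnKC mn) natrD -[LHS]addr0 => /addrI/esym/eqP.
by rewrite (pcharf0P k).1 // => /eqP ->; rewrite addn0.
Qed.

Lemma poly_nat_inj (p q : {poly k}) : (forall n : nat, p.[n%:R] = q.[n%:R]) -> p = q.
Proof.
move=> pq; apply/eqP; rewrite -subr_eq0; apply/negP=> /negP nz.
have := max_poly_roots nz (rs := [seq n%:R | n <- iota 0 (size (p - q))]).
rewrite size_map size_iota ltnn => /(_ _ _)/notF; apply.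
  by apply/allP=> _ /mapP[n _ ->]; rewrite /root hornerD hornerN pq subrr.
by rewrite map_inj_uniq ?iota_uniq //; apply: natr_inj0.
Qed.

(** Interpolation at 0, ..., N - 1 by the inverse Vandermonde matrix. As [c] does not depend on [p],
    coefficients can be extracted from operators polynomial in [n] using only their values. *)
Lemma coef_functional N i : exists c : 'I_N -> k, forall p : {poly k},
  (size p <= N)%N -> p`_i = \sum_m c m * p.[(m : nat)%:R].
Proof.
have [iN|Ni] := ltnP i N; last first.
  exists (fun=> 0) => p sp; rewrite nth_default ?(leq_trans sp) //.
  by rewrite big1 // => m _; rewrite mul0r.
pose a : 'rV[k]_N := \row_m (m : nat)%:R.
have Vu : Vandermonde N a \in unitmx.
  rewrite unitmxE det_Vandermonde unitfE; apply/prodf_neq0 => m _.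
  apply/prodf_neq0 => j mj; rewrite !mxE subr_eq0; apply/eqP => /natr_inj0.
  by move/eqP; rewrite gtn_eqF.
exists (fun m => invmx (Vandermonde N a) m (Ordinal iN)) => p sp.
have pV : poly_rV p *m Vandermonde N a = \row_m p.[(m : nat)%:R] :> 'rV_N.
  apply/rowP=> m; rewrite !mxE (horner_coef_wide _ sp).
  by apply: eq_bigr => j _; rewrite !mxE.
have := mulmxK Vu (poly_rV p : 'rV_N); rewrite pV => /rowP/(_ (Ordinal iN)).
by rewrite !mxE /= => <-; apply: eq_bigr => m _; rewrite mxE mulrC.
Qed.

Definition binpoly l : {poly k} := l`!%:R^-1 *: \prod_(i < l) ('X - (i : nat)%:R%:P).

Lemma size_binpoly l : (size (binpoly l) <= l.+1)%N.
Proof.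
apply: leq_trans (size_scale_leq _ _) _.
by rewrite size_prod_XsubC -[index_enum _]enumT size_enum_ord.
Qed.

Lemma binpoly_nat l n : (binpoly l).[n%:R] = 'C(n, l)%:R.
Proof.
rewrite hornerZ horner_prod.
have -> : \prod_(i < l) ('X - (i : nat)%:R%:P).[n%:R] = (n ^_ l)%:R :> k.
  elim: l => [|l IHl]; first by rewrite big_ord0 ffactn0.
  rewrite big_ord_recr IHl ffactnSr hornerXsubC natrM /=.
  have [ln|nl] := leqP l n; first by rewrite natrB.
  by rewrite ffact_small // !mul0r.
rewrite -bin_ffact natrM mulrC mulfK //.
by rewrite -[0]/(0%:R) (inj_eq natr_inj0) -lt0n fact_gt0.
Qed.

Lemma binpoly_coef0 l : (binpoly l)`_0 = (l == 0)%:R.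
Proof. by rewrite -horner_coef0 -[0]/(0%:R) binpoly_nat bin0n. Qed.

(** These are the coefficients of log(1 + t), since C(x, l) is the coefficient of t^l in exp(x log(1
    + t)). At [l = 0] the right side is 0, the inverse of 0 being 0. *)
Lemma binpoly_coef1 l : (binpoly l)`_1 = (-1) ^+ l.-1 / l%:R.
Proof.
case: l => [|l]; first by rewrite /binpoly big_ord0 coefZ coef1 mulr0 invr0 mulr0.
rewrite /binpoly big_ord_recl subr0 coefZ coefXM -horner_coef0 horner_prod.
have -> : \prod_(i < l) ('X - (bump 0 i)%:R%:P).[0] = (-1) ^+ l * l`!%:R :> k.
  elim: l => [|l IHl]; first by rewrite big_ord0 mulr1.
  rewrite big_ord_recr IHl hornerXsubC sub0r factS natrM exprSr /= /bump /= add1n.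
  by rewrite mulrN mulrN1 mulNr -mulrA [l.+1%:R * _]mulrC.
rewrite /= factS natrM invfM mulrCA -mulrA mulVf ?mulr1 //.
by rewrite -[0]/(0%:R) (inj_eq natr_inj0) -lt0n fact_gt0.
Qed.

(** Coefficientwise, d/dx (1 + t)^x = log(1 + t) (1 + t)^x. It results from differentiating
    Vandermonde's identity for C(m + n, l) with respect to m at m = 0. *)
Lemma binpoly_deriv l :
  (binpoly l)^`() = \sum_(i < l.+1) (binpoly i)`_1 *: binpoly (l - i).
Proof.
apply: poly_nat_inj => n; rewrite horner_sum.
have shift : binpoly l \Po ('X + n%:R%:P) =
    \sum_(i < l.+1) 'C(n, l - i)%:R *: binpoly i.
  apply: poly_nat_inj => m.
  rewrite horner_comp hornerD hornerX hornerC -natrD binpoly_nat -binomial.Vandermonde.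
  rewrite horner_sum natr_sum; apply: eq_bigr => i _.
  by rewrite hornerZ binpoly_nat -natrM mulnC.
have := congr1 (fun p => p^`().[0]) shift.
rewrite /= deriv_comp derivD derivX derivC addr0 mulr1 horner_comp.
rewrite hornerD hornerX hornerC add0r => ->.
rewrite linear_sum horner_sum; apply: eq_bigr => i _.
by rewrite /= derivZ 2!hornerZ binpoly_nat mulrC horner_coef0 coef_deriv.
Qed.

End BinomialPolynomials.

(** * The convolution logarithm of the identity *)

Section ConvolutionProduct.
Variables (k : fieldType) (h : bimonoid k) (U : finType).
Hypotheses (char0 : [pchar k] =i pred0).
Hypotheses (h_connected : connected h) (h_cocommutative : cocommutative h).
Implicit Types (A B C S T : {set U}) (s t g : seq {set U}).

Local Notation H A := (h (sset A)).
Local Notation fam := (family h U).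
Local Notation one := (fun _ _ => 1).
Implicit Types a b c : fam.

(** The convolution product, summed over decompositions of [A] by their first part. Writing
    [A :&: B] for [B] keeps the summand well typed for all [B]. *)
Definition star a b : fam := fun A =>
  \sum_(B : {set U} | B \subset A) conv (decomp_split A B) (a (A :&: B)) (b (A :\: B)).

(** The convolution unit, counit followed by unit, which is the identity on the empty set by
    connectedness; [posfam] is the identity minus it. *)
Definition unitfam : fam := fun A => if A == set0 then lid (H A) else 0.
Definition posfam : fam := fun A => if A == set0 then 0 else lid (H A).

Fixpoint spow a n : fam := if n is m.+1 then star a (spow a m) else unitfam.

Lemma star_suml n (x : 'I_n -> k) (a : 'I_n -> fam) b A :
  star (fun A => \sum_j x j *: a j A) b A = \sum_j x j *: star (a j) b A.
Proof.
rewrite /star; under eq_bigr do rewrite conv_suml.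
rewrite exchange_big; apply: eq_bigr => j _; rewrite scaler_sumr.
by apply: eq_bigr => B _; rewrite convZl.
Qed.

Lemma star_sumr n (x : 'I_n -> k) a (b : 'I_n -> fam) A :
  star a (fun A => \sum_j x j *: b j A) A = \sum_j x j *: star a (b j) A.
Proof.
rewrite /star; under eq_bigr do rewrite linear_sum.
rewrite exchange_big; apply: eq_bigr => j _; rewrite scaler_sumr.
by apply: eq_bigr => B _; rewrite linearZ.
Qed.

Lemma star_assoc a b c A : star (star a b) c A = star a (star b c) A.
Proof.
pose F (p : {set U} * {set U}) :=
  conv (decomp_split A p.1)
    (conv (decomp_split (A :&: p.1) p.2) (a (A :&: p.1 :&: p.2)) (b (A :&: p.1 :\: p.2)))
    (c (A :\: p.1)).
have -> : star (star a b) c A =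
    \sum_(p : {set U} * {set U} | (p.1 \subset A) && (p.2 \subset A :&: p.1)) F p.
  rewrite -(pair_big_dep (fun B => B \subset A) (fun B C => C \subset A :&: B)
     (fun B C => F (B, C))) /=.
  by apply: eq_bigr => B _; rewrite conv_suml.
have -> : star a (star b c) A =
    \sum_(p : {set U} * {set U} | (p.1 \subset A) && (p.2 \subset A :\: p.1))
       conv (decomp_split A p.1) (a (A :&: p.1))
         (conv (decomp_split (A :\: p.1) p.2) (b ((A :\: p.1) :&: p.2))
            (c (A :\: p.1 :\: p.2))).
  rewrite -(pair_big_dep (fun B => B \subset A) (fun B C => C \subset A :\: B)
     (fun B C => conv (decomp_split A B) (a (A :&: B))
         (conv (decomp_split (A :\: B) C) (b ((A :\: B) :&: C))
            (c (A :\: B :\: C))))) /=.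
  by apply: eq_bigr => B _; rewrite linear_sum.
(* A cut of [A] into three parts is given on the right by its first two parts [(B, C)], on the left
   by [(B :|: C, B)]. *)
rewrite (reindex_onto (fun p => (p.1 :|: p.2, p.1)) (fun p => (p.2, p.1 :\: p.2))) /=; last first.
  move=> [B C] /= /andP[BA]; rewrite subsetI => /andP[CA CB].
  by rewrite -{1}(setIidPr CB) setID.
apply: eq_big => [[B C]|[B C] /andP[/= /andP[]]] /=.
  rewrite xpair_eqE eqxx setDUl setDv set0U subsetI subUset subsetUl subsetD !andbT.
  rewrite (sameP eqP setDidPl).
  by case: (B \subset A) (C \subset A) [disjoint C & B] => [] [] [].
move=> BCA _; rewrite xpair_eqE => /andP[_ /eqP CE]; rewrite /F /=.
have BA : B \subset A by apply: subset_trans BCA; apply: subsetUl.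
have CA : C \subset A by apply: subset_trans BCA; apply: subsetUr.
have dis : C :&: B = set0.
  by rewrite -CE setDUl setDv set0U setIC setIDA setIC -setIDA setDv setI0.
have d1 : decomp (A :\: B) (A :&: (B :|: C) :\: B) (A :\: (B :|: C)).
  by apply/decompP=> x; rewrite !inE; do 3!case: (x \in _).
have d2 : decomp A (A :&: (B :|: C) :&: B) (A :\: B).
  by apply/decompP=> x; rewrite !inE; do 3!case: (x \in _).
rewrite (conv_assoc _ _ d1 d2).
have -> : conv d1 (b (A :&: (B :|: C) :\: B)) (c (A :\: (B :|: C))) =
   conv (decomp_split (A :\: B) C) (b ((A :\: B) :&: C)) (c (A :\: B :\: C)).
  apply: conv_eq; last by rewrite setDDl.
  by apply/setP=> x; move/setP/(_ x): dis; rewrite !inE; do 3!case: (x \in _).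
apply: (conv_eq a (fun X => conv (decomp_split X C) (b (X :&: C)) (c (X :\: C)))) => //.
by apply/setP=> x; rewrite !inE; do 3!case: (x \in _).
Qed.

Lemma star_unitl b A : star unitfam b A = b A.
Proof.
rewrite /star (bigD1 set0) ?sub0set //= big1 ?addr0 => [|B /andP[BA B0]].
  by rewrite (conv_unitl h_connected h_cocommutative) ?setI0 // /unitfam eqxx.
by rewrite /unitfam ifN ?conv0l // (setIidPr BA).
Qed.

Lemma star_unitr a A : star a unitfam A = a A.
Proof.
rewrite /star (bigD1 A) ?subxx //= big1 ?addr0 => [|B /andP[BA BnA]].
  by rewrite (conv_unitr h_connected) ?setDv // /unitfam eqxx.
rewrite /unitfam ifN ?linear0 //; apply: contraNneq BnA => AB.
by rewrite eqEsubset BA -setD_eq0 AB /=.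
Qed.

Lemma star_id b A : star (@idfam k h U) b A = b A + star posfam b A.
Proof.
rewrite -[in b A](star_unitl b A) /star -big_split; apply: eq_bigr => B _ /=.
rewrite -(linearD (convr (decomp_split A B) (b (A :\: B)))) /convr.
by rewrite /unitfam /posfam; case: ifP; rewrite ?addr0 ?add0r.
Qed.


(** A nonzero term would cut [A] into [n] nonempty parts. *)
Lemma spow_vanish a n A : a set0 = 0 -> (#|A| < n)%N -> spow a n A = 0.
Proof.
move=> a0; elim: n A => [|n IHn] A //= An; rewrite /star big1 // => B BA.
have [B0|B0] := eqVneq (A :&: B) set0.
  suff -> : a (A :&: B) = 0 by rewrite conv0l.
  by rewrite B0.
rewrite IHn ?linear0 // -ltnS; apply: leq_trans An; rewrite ltnS.
by rewrite -(cardsID B A) -[ltnLHS]add0n ltn_add2r card_gt0.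
Qed.

Lemma spow_add a i j A : spow a (i + j) A = star (spow a i) (spow a j) A.
Proof.
elim: i A => [|i IHi] A; first by rewrite star_unitl.
rewrite addSn [LHS]/= [spow a i.+1]/= star_assoc /star.
by apply: eq_bigr => B _; rewrite IHi.
Qed.

Lemma unitfam_comonoidal : comonoidal one unitfam.
Proof.
move=> A S T d; rewrite scale1r /unitfam.
have [A0|A0] := eqVneq A set0.
  have [SA TA] := (decomp_subl d, decomp_subr d).
  by rewrite !ifT ?ltensor_id ?lcomp1l ?lcomp1r // -subset0 -A0.
rewrite lcomp0r; case: ifP => [/eqP S0|_]; last by rewrite ltensor0l lcomp0l.
have TA : T = A by rewrite (decomp_eq d) S0 setD0.
by rewrite ifN ?TA // ltensor0r lcomp0l.
Qed.

Lemma star_comonoidal a b :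
  comonoidal one a -> comonoidal one b -> comonoidal one (star a b).
Proof.
move=> ca cb A S T d; rewrite scale1r /star lcomp_sumr.
have [SA TA] := (decomp_subl d, decomp_subr d); have dd := decompP _ _ _ d.
(* A subset of [A] amounts to a subset of [S] and one of [T], which matches the double sum on the
   right. *)
rewrite (reindex_onto (fun p : {set U} * {set U} => p.1 :|: p.2)
  (fun B => (S :&: B, T :&: B))) /=; last first.
  move=> B /subsetP BA; apply/setP=> x; move/implyP: (BA x); move: (dd x).
  by rewrite !inE; do 4!case: (x \in _).
rewrite ltensor_suml lcomp_suml.
under [RHS]eq_bigr do rewrite ltensor_sumr lcomp_suml.
rewrite pair_big_dep /=; apply: eq_big => [[B C]|[B C] /andP[/= BCA]] /=.
  apply/andP/andP => [[_]|[BS CT]]; rewrite xpair_eqE.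
    by case/andP=> /eqP<- /eqP<-; rewrite !subsetIl.
  split; first by rewrite subUset (subset_trans BS SA) (subset_trans CT TA).
  apply/andP; split; apply/eqP/setP=> x; move: (dd x);
    move/implyP: (subsetP BS x); move/implyP: (subsetP CT x); rewrite !inE;
    by do 5!case: (x \in _).
rewrite xpair_eqE => /andP[/eqP SB /eqP TC].
rewrite (comul_conv h_cocommutative (decomp_split A _) d (decomp_split S (B :|: C))
  (decomp_split T (B :|: C)) (ca _ _ _ (decomp_restrict _ d)) (cb _ _ _ (decomp_diff _ d))).
rewrite mul1r scale1r; congr (_ ⊠ _ ∘ _); apply: conv_eq.
all: apply/setP=> x; move/setP/(_ x): SB; move/setP/(_ x): TC; move: (dd x).
all: by rewrite !inE; do 5!case: (x \in _).
Qed.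

(** The convolution powers of the identity, also called Adams operations. *)
Fixpoint psi n : fam := if n is m.+1 then star (@idfam k h U) (psi m) else unitfam.

Lemma psi_comonoidal n : comonoidal one (psi n).
Proof.
elim: n => [|n IHn]; first exact: unitfam_comonoidal.
exact: star_comonoidal (@idfam_comonoidal k h U) IHn.
Qed.

Lemma psi1 A : psi 1 A = lid _.
Proof. exact: star_unitr. Qed.

Local Notation N := #|U|.+1.

(** Binomial theorem for [unitfam] plus [posfam], by Pascal's rule. Higher powers vanish on subsets
    of [U], so the range of [l] is the same for all [n] and [psi n] is polynomial in [n]. *)
Lemma psiE n A : psi n A = \sum_(l < N) 'C(n, l)%:R *: spow posfam l A.
Proof.
have pos0 : posfam set0 = 0 by rewrite /posfam eqxx.
elim: n A => [|n IHn] A.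
  rewrite big_ord_recl big1 ?addr0 ?scale1r // => i _.
  by rewrite scale0r.
rewrite [LHS]/= star_id IHn.
have -> : star posfam (psi n) A =
    \sum_(l < N) 'C(n, l)%:R *: spow posfam l.+1 A.
  by rewrite -star_sumr /star; apply: eq_bigr => B _; rewrite IHn.
rewrite [X in _ + X]big_ord_recr /= [star posfam _ _](@spow_vanish _ #|U|.+1)
  ?scaler0 ?addr0; last 2 first.
- by [].
- by rewrite ltnS max_card.
rewrite big_ord_recl [in RHS]big_ord_recl !bin0 -addrA -big_split; congr (_ + _).
by apply: eq_bigr => i _; rewrite lift0 /= binS natrD scalerDl.
Qed.

(* The coefficient of x^l in the convolution power id^{*x} = \sum_j 'C(x, j) posfam^{*j}. *)
Definition logc l : fam := fun A =>
  \sum_(j < N) (binpoly k j)`_l *: spow posfam j A.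

Lemma logc_set0 : logc 1 set0 = 0.
Proof.
rewrite /logc big1 // => -[[|j] Nj] _ /=.
  by rewrite binpoly_coef1 // invr0 mulr0 scale0r.
rewrite -/(spow posfam j.+1) spow_vanish ?scaler0 //; first by rewrite /posfam eqxx.
by rewrite cards0.
Qed.

(* The comultiplication of psi n into nonempty parts S and T is a product of two
   polynomials in n without constant term, so its linear coefficient vanishes. *)
Lemma logc1_primitive A S T (d : decomp A S T) : S != set0 -> T != set0 ->
  comul h d ∘ logc 1 A = 0.
Proof.
(* The bound [N + N] accommodates products of two binomial polynomials. *)
move=> S0 T0; have [c cP] := coef_functional char0 (N + N) 1.
have size_bin (i : 'I_N) : (size (binpoly k i) <= N)%N.
  exact: leq_trans (size_binpoly _ _) (ltn_ord i).
have -> : logc 1 A = \sum_m c m *: psi m A.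
  under [RHS]eq_bigr do rewrite psiE scaler_sumr.
  rewrite exchange_big; apply: eq_bigr => i _ /=.
  rewrite cP ?(leq_trans (size_bin i)) ?leq_addr // scaler_suml.
  by apply: eq_bigr => m _; rewrite binpoly_nat // scalerA.
rewrite lcomp_sumr.
under eq_bigr => m _.
  rewrite lcompZr psi_comonoidal scale1r !psiE ltensor_suml.
  under eq_bigr do rewrite ltensorZl ltensor_sumr.
  under eq_bigr do under eq_bigr do rewrite ltensorZr.
  over.
rewrite /=.
have -> : \sum_m c m *: ((\sum_(i < N) 'C(m, i)%:R *:
    \sum_(j < N) 'C(m, j)%:R *: (spow posfam i S ⊠ spow posfam j T)) ∘ comul h d) =
  \sum_(i < N) \sum_(j < N) (binpoly k i * binpoly k j)`_1 *:
     ((spow posfam i S ⊠ spow posfam j T) ∘ comul h d).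
  under eq_bigr => m _.
    rewrite lcomp_sumZl scaler_sumr.
    under eq_bigr do rewrite lcomp_sumZl !scaler_sumr.
    over.
  rewrite exchange_big; apply: eq_bigr => i _ /=.
  rewrite exchange_big; apply: eq_bigr => j _ /=.
  rewrite cP; last first.
    apply: leq_trans (size_polyMleq _ _) _.
    by apply: leq_trans (leq_pred _) _; apply: leq_add.
  rewrite scaler_suml; apply: eq_bigr => m _.
  by rewrite hornerM !binpoly_nat // !scalerA mulrA.
(* Each term of the linear coefficient takes a constant coefficient from one factor. This is nonzero
   only at index 0, where [spow] is [unitfam] and vanishes on a nonempty part. *)
apply: big1 => i _; apply: big1 => j _; rewrite coefM big_ord_recl big_ord1 /=.
rewrite !binpoly_coef0 //.
case: eqVneq => [->|i0]; first by rewrite /= /unitfam (negbTE S0) ltensor0l lcomp0l scaler0.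
case: eqVneq => [->|j0]; first by rewrite /= /unitfam (negbTE T0) ltensor0r lcomp0l scaler0.
by rewrite mul0r mulr0 addr0 scale0r.
Qed.

(** The logarithm itself is 0 on the empty set; the identity is put there so that empty parts are
    neutral in [run]. *)
Definition logfam : fam := fun A => if A == set0 then lid (H A) else logc 1 A.

Lemma logfam0 : logfam set0 = lid _.
Proof. by rewrite /logfam eqxx. Qed.

Lemma logfam_comonoidal : comonoidal (@primitive_weight k U) logfam.
Proof.
move=> A S T d; rewrite /primitive_weight.
have [S0|S0] := eqVneq S set0.
  have TA : T = A by rewrite (decomp_eq d) S0 setD0.
  subst S T; rewrite scale1r logfam0; apply: lmap_eq => x.
  by rewrite !lcompE !(comul_unitl h_connected) // ltensor_pure.
have [T0|T0] := eqVneq T set0.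
  have SA : S = A by rewrite (decomp_eq (decompC d)) T0 setD0.
  subst S T; rewrite scale1r logfam0; apply: lmap_eq => x.
  by rewrite !lcompE !(comul_unitr h_connected) // ltensor_pure.
rewrite scale0r /logfam ifN ?logc1_primitive //.
apply: contra_neq S0 => A0; apply/eqP.
by rewrite -subset0 -A0 (decomp_subl d).
Qed.

Lemma logc0 A : logc 0 A = unitfam A.
Proof.
rewrite /logc big_ord_recl big1 ?addr0 => [|i _].
  by rewrite binpoly_coef0 // scale1r.
by rewrite binpoly_coef0 // scale0r.
Qed.

(** The coefficient of x^l in d/dx id^{*x} = log(id) * id^{*x}, an identity that comes from
    [binpoly_deriv]. *)
Lemma star_logc l A : star (logc 1) (logc l) A = l.+1%:R *: logc l.+1 A.
Proof.
have pos0 : posfam set0 = 0 by rewrite /posfam eqxx.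
rewrite star_suml.
under eq_bigr do rewrite star_sumr scaler_sumr.
under eq_bigr do under eq_bigr do rewrite -spow_add scalerA.
(* Terms are collected by [m = i + j]; those with [m] beyond [#|U|] involve vanishing powers. *)
have shift (i : 'I_N) : \sum_(j < N) ((binpoly k i)`_1 * (binpoly k j)`_l) *:
      spow posfam (i + j) A =
    \sum_(m < N) (if (i <= m)%N then (binpoly k i)`_1 * (binpoly k (m - i))`_l else 0) *:
      spow posfam m A.
  pose f m := (if (i <= m)%N then (binpoly k i)`_1 * (binpoly k (m - i))`_l else 0) *:
      spow posfam m A.
  transitivity (\sum_(0 <= m < N) f m); last by rewrite big_mkord.
  rewrite [RHS](@big_cat_nat _ _ _ i) ?(ltnW (ltn_ord i)) //=.
  rewrite [X in _ = X + _]big_nat [X in _ = X + _]big1 ?add0r => [|m /= mi]; last first.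
    by rewrite /f leqNgt mi scale0r.
  rewrite -{3}[i : nat]add0n big_addn.
  transitivity (\sum_(0 <= j < N) ((binpoly k i)`_1 * (binpoly k j)`_l) *:
      spow posfam (i + j) A); first by rewrite big_mkord.
  rewrite (@big_cat_nat _ _ _ (N - i)) ?leq_subr //=.
  rewrite [X in _ + X]big_nat [X in _ + X]big1 ?addr0 => [|j /andP[Nij _]]; last first.
    rewrite spow_vanish ?scaler0 // (leq_trans _ (_ : N <= i + j)%N) ?ltnS ?max_card //.
    by rewrite -leq_subLR.
  by apply: eq_bigr => j _; rewrite /f leq_addl addnK addnC.
under eq_bigr do rewrite shift.
rewrite exchange_big scaler_sumr; apply: eq_bigr => m _ /=.
rewrite -scaler_suml scalerA; congr (_ *: _).
rewrite mulrC mulr_natr -coef_deriv binpoly_deriv // coef_sum.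
rewrite -big_mkcond /= (big_ord_widen_cond N xpredT
  (fun i => ((binpoly k i)`_1 *: binpoly k (m - i))`_l)) ?ltn_ord //.
by apply: eq_big => i; rewrite ?ltnS // => _; rewrite coefZ.
Qed.

(** The recursion [star_logc] solved: coefficientwise, id^{*x} = exp(x log(id)). *)
Lemma logcE l A : logc l A = l`!%:R^-1 *: spow (logc 1) l A.
Proof.
elim: l A => [|l IHl] A; first by rewrite logc0 invr1 scale1r.
have l0 : l.+1%:R != 0 :> k by rewrite (pcharf0P k).1.
apply: (scalerI l0); rewrite -star_logc factS natrM invfM !scalerA mulrA mulfV // mul1r.
rewrite /= /star scaler_sumr; apply: eq_bigr => B _.
by rewrite IHl linearZ.
Qed.

(** The value at x = 1 of id^{*x}, that is, exp(log(id)) = id. *)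
Lemma lid_spow_log A : lid (H A) = \sum_(l < N) l`!%:R^-1 *: spow (logc 1) l A.
Proof.
under eq_bigr do rewrite -logcE.
rewrite exchange_big -psi1 psiE; apply: eq_bigr => j _ /=.
rewrite -scaler_suml -binpoly_nat // (horner_coef_wide _ (n := N)).
  by congr (_ *: _); apply: eq_bigr => l _; rewrite expr1n mulr1.
exact: leq_trans (size_binpoly _ _) (ltn_ord j).
Qed.

End ConvolutionProduct.

(** * Compositions and their refinements *)

Section CompositionLists.
Variable U : finType.
Implicit Types (A B C S T : {set U}) (s t g : seq {set U}).

(** Compositions of an arbitrary subset as plain lists, since inductions on the list pass to the
    complement of its first block. *)
Definition composition_of A s : bool :=
  [&& all (fun B => B != set0) s, pairwise_disjoint s & \bigcup_(B <- s) B == A].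

Lemma composition_of_cons A B s :
  composition_of A (B :: s) =
  [&& B \subset A, B != set0 & composition_of (A :\: B) s].
Proof.
rewrite /composition_of /= big_cons.
apply/and3P/and3P => [[/andP[B0 s0] /andP[Bs ds] /eqP <-]|[BA B0 /and3P[s0 ds /eqP su]]].
  rewrite subsetUl B0 s0 ds setDUl setDv set0U; split=> //=.
  apply/eqP/esym/setDidPl; rewrite disjoint_sym.
  exact: disjoint_bigcup_seq.
rewrite B0 s0 ds su setDE setUIr setUCr setIT; split=> //; last exact/eqP/setUidPr.
rewrite andbT; apply/allP=> C Cs; rewrite disjoint_sym disjoint_subset.
apply/subsetP=> x xC; have : x \in \bigcup_(D <- s) D.
  by apply/(subsetP (bigcup_mem Cs)).
by rewrite su !inE => /andP[].
Qed.

Fixpoint compositions n A : seq (seq {set U}) :=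
  if n is m.+1 then
    [seq B :: s | B <- enum [pred B : {set U} | (B \subset A) && (B != set0)],
                  s <- compositions m (A :\: B)]
  else if A == set0 then [:: [::]] else [::].

Lemma mem_compositions n A s :
  (s \in compositions n A) = (size s == n) && composition_of A s.
Proof.
elim: n A s => [|n IHn] A s /=.
  case: s => [|B s] /=; last by case: ifP.
  by rewrite /composition_of big_nil /= eq_sym; case: eqP.
case: s => [|B s].
  by apply/negP=> /allpairsPdep[B [s [_ _]]].
rewrite composition_of_cons /= eqSS.
apply/allpairsPdep/idP => [[C [t [+ + [-> ->]]]]|].
  by rewrite mem_enum inE IHn => /andP[-> ->] /andP[-> ->].
case/andP=> sn /and3P[BA B0 cs]; exists B, s.
by rewrite mem_enum inE BA B0 IHn sn cs.
Qed.

Lemma compositions_uniq n A : uniq (compositions n A).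
Proof.
elim: n A => [|n IHn] A /=; first by case: ifP.
apply: allpairs_uniq_dep => [|B _|]; [exact: enum_uniq | exact: IHn |].
by move=> [B s] [C t] _ _ /= [-> ->].
Qed.

Definition all_compositions A := flatten [seq compositions n A | n <- iota 0 #|U|.+1].

Lemma mem_all_compositions A s : (s \in all_compositions A) = composition_of A s.
Proof.
apply/flatten_mapP/idP => [[n _]|cs].
  by rewrite mem_compositions => /andP[].
exists (size s); last by rewrite mem_compositions eqxx.
rewrite mem_iota /= add0n ltnS; case/and3P: cs => s0 ds _.
exact: leq_trans (size_pairwise_disjoint s0 ds) (max_card _).
Qed.

Lemma all_compositions_uniq A : uniq (all_compositions A).
Proof.
have := iota_uniq 0 #|U|.+1; rewrite /all_compositions.
elim: (iota _ _) => [|n r IHr] // /andP[nr /IHr ur] /=.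
rewrite cat_uniq compositions_uniq ur andbT /=.
apply/hasPn=> s /flatten_mapP[m mr]; rewrite !mem_compositions => /andP[/eqP sm _].
by apply: contraNN nr => /andP[/eqP <- _]; rewrite sm.
Qed.

Lemma big_all_compositions (V : zmodType) A (Phi : seq {set U} -> V) :
  \sum_(s <- all_compositions A) Phi s =
  \sum_(n < #|U|.+1) \sum_(s <- compositions n A) Phi s.
Proof.
rewrite /all_compositions big_flatten big_map.
by rewrite -(big_mkord xpredT (fun n => \sum_(s <- compositions n A) Phi s)) /index_iota subn0.
Qed.

Fixpoint refinements s : seq (seq {set U}) :=
  if s is B :: s' then
    [seq g ++ t | g <- all_compositions B, t <- refinements s']
  else [:: [::]].

(** The existential is that of [comp_le]; its pieces [gs] are the compositions chosen in the
    successive blocks of [s]. *)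
Lemma mem_refinements s t :
  all (fun B => B != set0) s -> pairwise_disjoint s ->
  reflect [/\ all (fun B => B != set0) t, pairwise_disjoint t &
    exists gs : seq (seq {set U}),
      flatten gs = t /\ [seq \bigcup_(C <- g) C | g <- gs] = s]
  (t \in refinements s).
Proof.
elim: s t => [|B s IHs] t.
  move=> _ _; rewrite inE; apply: (iffP eqP) => [->|[_ _ [gs [<-]]]].
    by split=> //; exists [::].
  by case: gs.
move=> /= /andP[B0 s0] /andP[Bs ds]; apply: (iffP idP).
  case/allpairsP=> -[g t'] /= []; rewrite mem_all_compositions => /and3P[g0 dg /eqP gB].
  case/IHs => // t0 dt [gs [tE sE]] ->.
  split; last by exists (g :: gs); rewrite /= tE gB sE.
    by rewrite all_cat g0.
  rewrite /pairwise_disjoint pairwise_cat; apply/and3P; split=> //.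
  apply/allrelP=> C D Cg Dt.
  have CB : C \subset B by rewrite -gB bigcup_mem.
  have Ds : D \subset \bigcup_(E <- s) E.
    apply: subset_trans (bigcup_mem Dt) _.
    by rewrite -tE -sE big_map big_flatten.
  apply: disjointWl CB _; apply: disjointWr Ds _.
  exact: disjoint_bigcup_seq.
case=> t0 dt [[|g gs] [//= tE [gB sE]]].
apply/allpairsP; exists (g, flatten gs); split=> //=; last first.
  apply/IHs => //; split; last by exists gs.
    by move: t0; rewrite -tE all_cat => /andP[].
  by move: dt; rewrite -tE /pairwise_disjoint pairwise_cat => /and3P[].
rewrite mem_all_compositions /composition_of gB eqxx andbT.
move: t0 dt; rewrite -tE all_cat /pairwise_disjoint pairwise_cat => /andP[-> _].
by case/and3P.
Qed.

Lemma refinements_bigcup s t : all (fun B => B != set0) s -> pairwise_disjoint s ->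
  t \in refinements s -> \bigcup_(C <- t) C = \bigcup_(B <- s) B.
Proof.
move=> s0 ds /mem_refinements[] // _ _ [gs [<- <-]].
by rewrite big_map big_flatten.
Qed.

Lemma size_refinements s t : all (fun B => B != set0) s -> t \in refinements s ->
  (size s <= size t)%N.
Proof.
elim: s t => [|B s IHs] t //= /andP[B0 s0] /allpairsP[[g t'] /= [gB t's ->]].
rewrite size_cat -add1n leq_add ?IHs //.
case: g gB => //; rewrite mem_all_compositions /composition_of big_nil /= eq_sym.
by rewrite (negbTE B0).
Qed.

Lemma count_subset_all B g : \bigcup_(C <- g) C = B ->
  count (fun C : {set U} => C \subset B) g = size g.
Proof.
by move=> <-; apply/eqP; rewrite -all_count; apply/allP=> C; apply: bigcup_mem.
Qed.

Lemma count_subset0 B t : all (fun C => C != set0) t ->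
  [disjoint B & \bigcup_(C <- t) C] -> count (fun C : {set U} => C \subset B) t = 0%N.
Proof.
move=> /allP t0 dB; apply/eqP; rewrite -leqn0 leqNgt -has_count.
apply/hasPn=> C Ct; apply: contraNN (t0 C Ct) => CB.
rewrite -subset0 -(disjoint_setI0 dB) subsetI CB.
exact: bigcup_mem.
Qed.

(** In [g ++ t] the members of [g] are exactly the blocks contained in [B], so the concatenation
    determines both pieces. *)
Lemma refinements_uniq s : all (fun B => B != set0) s -> pairwise_disjoint s ->
  uniq (refinements s).
Proof.
elim: s => [|B s IHs] //= /andP[B0 s0] /andP[Bs ds].
apply: allpairs_uniq; [exact: all_compositions_uniq | exact: IHs |].
have key g t : g \in all_compositions B -> t \in refinements s ->
    [seq C : {set U} <- g ++ t | C \subset B] = g.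
  rewrite mem_all_compositions => /and3P[_ _ /eqP gB] ts.
  have [t0 _ _] := mem_refinements t s0 ds ts.
  rewrite filter_cat.
  have /all_filterP -> : all (fun C : {set U} => C \subset B) g.
    by apply/allP=> C; rewrite -gB; apply: bigcup_mem.
  rewrite -[RHS]cats0; congr (_ ++ _).
  apply/nilP; rewrite /nilp size_filter count_subset0 //.
  by rewrite (refinements_bigcup s0 ds ts) disjoint_bigcup_seq.
move=> [g t] [g' t'] /allpairsP[[a b] /= [ga tb [-> ->]]].
case/allpairsP=> -[a' b'] /= [ga' tb' [-> ->]] eqc.
have aE : a = a' by rewrite -(key a b) // eqc key.
by move/eqP: eqc; rewrite aE eqseq_cat // eqxx => /eqP ->.
Qed.

Definition refinement_coef (k : fieldType) s t : k :=
  (-1) ^+ (size t - size s) /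
  (\prod_(B <- s) count (fun C : {set U} => C \subset B) t)%:R.

(** The coefficient is multiplicative over the blocks of the coarser list, with a coefficient of the
    logarithm series for each: this is why Q_F acts as a product of logarithms. *)
Lemma refinement_coef_cat (k : fieldType) B s g t :
  all (fun B => B != set0) (B :: s) -> pairwise_disjoint (B :: s) ->
  g \in all_compositions B -> t \in refinements s ->
  refinement_coef k (B :: s) (g ++ t) =
  (-1) ^+ (size g).-1 / (size g)%:R * refinement_coef k s t.
Proof.
move=> /= /andP[B0 s0] /andP[Bs ds] gB ts.
have [t0 _ _] := mem_refinements t s0 ds ts.
have := gB; rewrite mem_all_compositions => /and3P[g0 dg /eqP gE].
have g1 : (0 < size g)%N.
  by case: g gE {gB g0 dg} => //; rewrite big_nil => E; rewrite -E eqxx in B0.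
have ts' := size_refinements s0 ts.
have dB : [disjoint B & \bigcup_(C <- s) C] by apply: disjoint_bigcup_seq.
rewrite /refinement_coef big_cons count_cat (count_subset_all gE).
rewrite count_subset0 ?(refinements_bigcup s0 ds ts) // addn0.
have -> : \prod_(C <- s) count (fun D : {set U} => D \subset C) (g ++ t) =
          \prod_(C <- s) count (fun D : {set U} => D \subset C) t.
  apply: eq_big_seq => C Cs; rewrite count_cat count_subset0 ?add0n // gE.
  by rewrite disjoint_sym; apply: (allP Bs).
rewrite natrM invfM mulrACA -exprD size_cat /=; congr (_ ^+ _ * _).
by lia.
Qed.

End CompositionLists.

(** * The action of the Garsia–Reutenauer elements *)

Section Global.
Variables (k : fieldType) (h : bimonoid k) (I : finType).
Hypotheses (char0 : [pchar k] =i pred0) (I_nonempty : (0 < #|I|)%N).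
Hypotheses (h_connected : connected h) (h_cocommutative : cocommutative h).
Implicit Types (A B C S T : {set I}) (s t g : seq {set I}) (F G : composition I).

Local Notation H A := (h (sset A)).
Local Notation fam := (family h I).
Local Notation HI := (H [set: I]).
Local Notation P := (run (@idfam k h I)).
Local Notation Q := (run (@logfam k h I)).

(** Empty parts contribute nothing because [a] vanishes there; [b] may take another value on the
    empty set, as [idfam] and [logfam] do. *)
Lemma spow_compositions (a b : fam) n A : a set0 = 0 ->
  (forall B, B != set0 -> a B = b B) ->
  spow a n A = \sum_(s <- compositions n A) run b s A.
Proof.
move=> a0 ab; elim: n A => [|n IHn] A /=.
  rewrite /unitfam; case: eqP => _; last by rewrite big_nil.
  by rewrite big_seq1.
rewrite big_allpairs_dep big_enum_cond /= /star.
rewrite (bigID (fun B => B != set0)) /= [X in _ + X]big1 ?addr0 => [|B /andP[BA /negPn/eqP ->]].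
  apply: eq_big => [B|B /andP[BA B0]]; first by rewrite inE andbT.
  by rewrite ab ?(setIidPr BA) // IHn linear_sum.
suff -> : a (A :&: set0) = 0 by rewrite conv0l.
by rewrite setI0.
Qed.

Lemma mu1_linear B s (d : pairwise_disjoint (B :: s)) : linear (mu1 (h := h) d).
Proof.
elim: s B d => [|C s IHs] B d c x y //=.
by rewrite tmap_linear ?mu_in_linear // => a' x' y'; apply: IHs.
Qed.

Lemma Delta1_linear B s (d : pairwise_disjoint (B :: s)) : linear (Delta1 (h := h) d).
Proof.
elim: s B d => [|C s IHs] B d c x y //=.
by rewrite Delta_in_linear tmap_linear // => a' x' y'; apply: IHs.
Qed.

Definition mu1L B s d := Lmap (@mu1_linear B s d).
Definition Delta1L B s d := Lmap (@Delta1_linear B s d).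

Lemma mu1L_cons B C s (d : pairwise_disjoint [:: B, C & s]) :
  mu1L d = mul h (decomp_cons d) ∘ (lid _ ⊠ mu1L (pairwise_disjoint_behead d)).
Proof. exact: lmap_eq. Qed.

Lemma Delta1L_cons B C s (d : pairwise_disjoint [:: B, C & s]) :
  Delta1L d = (lid _ ⊠ Delta1L (pairwise_disjoint_behead d)) ∘ comul h (decomp_cons d).
Proof. exact: lmap_eq. Qed.

Lemma mu1_Delta1 B s (d : pairwise_disjoint (B :: s)) :
  mu1L d ∘ Delta1L d = P (B :: s) (union1 B s).
Proof.
elim: s B d => [|C s IHs] B d.
  rewrite [RHS](conv_unitr h_connected (@idfam k h I) (b := @idfam k h I)) ?setDv //.
  exact: lmap_eq.
rewrite mu1L_cons Delta1L_cons -!lcompA (lcompA (_ ⊠ _)) ltensor_comp IHs lcomp1l lcompA.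
rewrite -/(conv (decomp_cons d) (lid _) _).
have dd := decompP _ _ _ (decomp_cons d).
apply: (conv_eq (@idfam k h I) (P (C :: s))); apply/setP=> x; move: (dd x);
  by rewrite !inE; do 2!case: (x \in _).
Qed.

(** In the bimonoid axiom for twice the same decomposition the four pieces are S, ∅, ∅ and T, and
    the unit and counit laws apply. *)
Lemma comul_mulK A S T (d : decomp A S T) : comul h d ∘ mul h d = lid _.
Proof.
rewrite (comul_mul h d d (decomps0 S) (decomp0s T) (decomps0 S) (decomp0s T)).
apply: tensor_ext => v w; rewrite !lcompE ltensor_pure.
rewrite (comul_unitr h_connected) (comul_unitl h_connected) // linterchange_pure.
by rewrite ltensor_pure mul_unitr mul_unitl.
Qed.

(** With [mu1_Delta1], this makes [P (B :: s)] on the union of the blocks an idempotent whose image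
    is a copy of their tensor product. *)
Lemma Delta1_mu1 B s (d : pairwise_disjoint (B :: s)) :
  Delta1L d ∘ mu1L d = lid _.
Proof.
elim: s B d => [|C s IHs] B d; first exact: lmap_eq.
rewrite mu1L_cons Delta1L_cons -!lcompA (lcompA (comul h _)) comul_mulK lcomp1l.
by rewrite ltensor_comp IHs lcomp1l ltensor_id.
Qed.

Definition to_setT : lmap (h I) HI :=
  lmap_of (sp_map h (to_sset_bij (erefl [set: I]))).
Definition of_setT : lmap HI (h I) :=
  lmap_of (sp_map h (sset_setT_bij (erefl [set: I]))).

Lemma to_setTK : of_setT ∘ to_setT = lid _.
Proof.
apply: lmap_eq => x; rewrite lcompE /=.
have b : bijective ((val : sset [set: I] -> I) \o to_sset (erefl [set: I])).
  exact: bij_comp (sset_setT_bij (erefl _)) (to_sset_bij (erefl _)).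
by rewrite -(sp_map_comp _ _ b); have -> := sp_map_id b x.
Qed.

Lemma of_setTK : to_setT ∘ of_setT = lid _.
Proof.
apply: lmap_eq => x; rewrite lcompE /=.
have b : bijective (to_sset (erefl [set: I]) \o (val : sset [set: I] -> I)).
  exact: bij_comp (to_sset_bij (erefl _)) (sset_setT_bij (erefl _)).
rewrite -(sp_map_comp _ _ b).
have E : to_sset (erefl [set: I]) \o (val : sset [set: I] -> I) = id.
  by apply/funext=> y; apply: val_inj.
by move: b; rewrite E => b; rewrite sp_map_id.
Qed.

(** Conjugation by the identification of h[I] with [h] of the full subset; it carries the identities
    between values of [run] over to h[I]. *)
Definition glob (f : lmap HI HI) : lmap (h I) (h I) := of_setT ∘ f ∘ to_setT.

Lemma glob_comp (f g : lmap HI HI) : glob f ∘ glob g = glob (f ∘ g).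
Proof.
by rewrite /glob !lcompA -(lcompA _ to_setT of_setT) of_setTK lcomp1r.
Qed.

Lemma glob_id : glob (lid _) = lid _.
Proof. by rewrite /glob lcomp1r to_setTK. Qed.

Lemma glob_linear : linear glob.
Proof. by move=> c f g; rewrite /glob lcomp_linearr lcomp_linearl. Qed.

HB.instance Definition _ := GRing.isLinear.Build k _ _ *:%R glob glob_linear.

Lemma blocks_nonempty F : blocks F != [::].
Proof.
apply/eqP=> F0; have := valP F; rewrite -/(blocks F) F0 /is_composition big_nil /=.
by move=> /eqP I0; move: I_nonempty; rewrite -cardsT -I0 cards0.
Qed.

Lemma transport_setT A (A1 : A = [set: I]) (f : forall B, lmap (H B) (H B)) x :
  sp_map h (sset_setT_bij A1) (f A (sp_map h (to_sset_bij A1) x)) =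
  glob (f [set: I]) x.
Proof. by subst A. Qed.

Lemma mu_Delta_seq s (c : is_composition s) x : s != [::] ->
  mu_seq c (Delta_seq (h := h) c x) = glob (P s [set: I]) x.
Proof.
case: s c => // B s c _; rewrite -(transport_setT (composition_union c) (P (B :: s))).
by rewrite -(mu1_Delta1 (composition_disjoint c)).
Qed.

Lemma Delta_mu_seq s (c : is_composition s) (t : tensor_blocks h s) : s != [::] ->
  Delta_seq c (mu_seq (h := h) c t) = t.
Proof.
case: s c t => // B s c t _ /=.
have -> z : sp_map h (to_sset_bij (composition_union c))
   (sp_map h (sset_setT_bij (composition_union c)) z) = z.
  move: z; set A := union1 B s; move: (composition_union c); rewrite -/A => A1 z.
  have b : bijective (to_sset A1 \o (val : sset A -> I)).
    exact: bij_comp (to_sset_bij A1) (sset_setT_bij A1).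
  rewrite -(sp_map_comp _ _ b).
  have E : to_sset A1 \o (val : sset A -> I) = id.
    by apply/funext=> y; apply: val_inj.
  by move: b; rewrite E => b; rewrite sp_map_id.
exact: (congr1 (fun f : lmap _ _ => f t) (Delta1_mu1 (composition_disjoint c))).
Qed.

Definition PsiL (z : Sigma k I) : lmap (h I) (h I) := Lmap (Psi_linear (h := h) z).

Lemma PsiL_linear : linear PsiL.
Proof.
move=> c z z'; apply: lmap_eq => x; rewrite laddE lscaleE /= /Psi scaler_sumr -big_split.
by apply: eq_bigr => F _; rewrite !ffunE scalerDl scalerA.
Qed.

HB.instance Definition _ := GRing.isLinear.Build k _ _ *:%R PsiL PsiL_linear.

Lemma PsiL_Hbasis F : PsiL (Hbasis k F) = glob (P (blocks F) [set: I]).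
Proof.
apply: lmap_eq => x; rewrite /= /Psi (bigD1 F) //= big1 ?addr0 => [|G GF].
  by rewrite ffunE eqxx scale1r /mu_comp /Delta_comp mu_Delta_seq // blocks_nonempty.
by rewrite ffunE (negbTE GF) scale0r.
Qed.

(** Passage from sums over the type of compositions to sums over duplicate-free lists, where
    induction on blocks is possible. *)
Lemma big_compositions (V : zmodType) (R : pred (composition I)) r (Phi : seq {set I} -> V) :
  uniq r -> (forall s, reflect (exists2 F, R F & blocks F = s) (s \in r)) ->
  \sum_(F | R F) Phi (blocks F) = \sum_(s <- r) Phi s.
Proof.
move=> ur rP.
transitivity (\sum_(F <- enum R) Phi (blocks F)); first by rewrite big_enum.
rewrite -(big_map (@blocks I) xpredT Phi); apply: perm_big.
apply: uniq_perm => //.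
  rewrite map_inj_uniq ?enum_uniq // => F G FG.
  by do 2!apply: val_inj.
move=> s; apply/mapP/rP => [[F]|[F RF <-]].
  by rewrite mem_enum => RF ->; exists F.
by exists F; rewrite // mem_enum.
Qed.

Lemma composition_exists s : is_composition s -> exists F, blocks F = s.
Proof.
by move=> c; exists (exist _ (Bseq (size_composition c)) c).
Qed.

Lemma big_refinements (V : zmodType) F (Phi : seq {set I} -> V) :
  \sum_(G | comp_le F G) Phi (blocks G) = \sum_(s <- refinements (blocks F)) Phi s.
Proof.
have /and3P[F0 dF /eqP uF] := valP F.
apply: big_compositions => [|s]; first exact: refinements_uniq.
apply: (iffP (mem_refinements _ F0 dF)) => [[s0 ds [gs [sE FE]]]|[G /asboolP FG <-]].
  have [G GE] : exists G, blocks G = s.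
    apply: composition_exists; rewrite /is_composition s0 ds -sE big_flatten /=.
    by rewrite -(big_map (fun g => \bigcup_(C <- g) C) xpredT id) FE uF.
  by exists G => //; apply/asboolP; exists gs; rewrite GE.
by have /and3P[] := valP G.
Qed.

(** The logarithm at the first block expands over the compositions of that block; convolved with the
    expansion for the other blocks, it yields the refinements with their coefficients. *)
Lemma run_log_refinements s A : composition_of A s ->
  Q s A = \sum_(t <- refinements s) refinement_coef k s t *: P t A.
Proof.
elim: s A => [|B s IHs] A.
  by move=> _; rewrite big_seq1 /refinement_coef big_nil /= divr1 scale1r.
move=> cs; have := cs; rewrite composition_of_cons => /and3P[BA B0 cs'].
have /and3P[s0 ds _] := cs.
rewrite big_allpairs_dep /= (IHs _ cs').
have logB : logfam h B = \sum_(g <- all_compositions B)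
    ((-1) ^+ (size g).-1 / (size g)%:R) *: P g B.
  rewrite /logfam (negbTE B0) /logc big_all_compositions; apply: eq_bigr => j _.
  rewrite (spow_compositions (b := @idfam k h I)); first last.
  - by move=> C C0; rewrite /posfam (negbTE C0).
  - by rewrite /posfam eqxx.
  rewrite binpoly_coef1 // scaler_sumr; apply: eq_big_seq => g.
  by rewrite mem_compositions => /andP[/eqP ->].
have dBA : decomp A B (A :\: B) by apply: decomp_subset.
have -> : conv (decomp_split A B) (logfam h (A :&: B))
   (\sum_(t <- refinements s) refinement_coef k s t *: P t (A :\: B)) =
   conv dBA (logfam h B)
   (\sum_(t <- refinements s) refinement_coef k s t *: P t (A :\: B)).
  apply: (conv_eq (@logfam k h I)
    (fun X => \sum_(t <- refinements s) refinement_coef k s t *: P t X)) => //.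
  exact/setIidPr.
rewrite logB conv_suml; apply: eq_big_seq => g gB.
rewrite convZl linear_sum scaler_sumr; apply: eq_big_seq => t ts.
rewrite refinement_coef_cat // linearZ scalerA; congr (_ *: _).
have := gB; rewrite mem_all_compositions => /and3P[_ _ /eqP gE].
rewrite (run_cat _ _ _ dBA) // gE ?subxx //.
by rewrite setIC setIDA setIC -setIDA setDv setI0.
Qed.

Lemma PsiL_Qbasis F : PsiL (Qbasis k F) = glob (Q (blocks F) [set: I]).
Proof.
rewrite (run_log_refinements (valP F)).
rewrite -(big_refinements F (fun t => refinement_coef k (blocks F) t *: P t _)).
rewrite /Qbasis !linear_sum; apply: eq_bigr => G _.
by rewrite !linearZ /= PsiL_Hbasis.
Qed.

Definition EL (X : set_partition I) : lmap HI HI :=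
  (#|val X|)`!%:R^-1 *: \sum_(F | supp F == val X) Q (blocks F) [set: I].

Lemma PsiL_GR X : PsiL (GR_idempotent k X) = glob (EL X).
Proof.
rewrite /GR_idempotent /EL !linearZ !linear_sum /=; congr (_ *: _).
by apply: eq_bigr => F _; rewrite PsiL_Qbasis.
Qed.

End Global.

(** * Idempotents, traces and dimensions *)

Section LinearAlgebra.
Variable k : fieldType.
Implicit Types V W : lmodType k.

(** Expressing each basis in the other gives matrices with product 1, which bounds one size by the
    other. *)
Lemma has_dim_inj V (P : V -> Prop) n m : has_dim P n -> has_dim P m -> n = m.
Proof.
suff le n' m' : has_dim P n' -> has_dim P m' -> (n' <= m')%N.
  by move=> Pn Pm; apply/eqP; rewrite eqn_leq !le.
move=> [b [Pb bP]] [c [Pc cP]].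
have [A AE] : exists A : 'M[k]_(n', m'), forall i, b i = \sum_j A i j *: c j.
  have /choice[A AE] : forall i, exists a : {ffun 'I_m' -> k}, b i = \sum_j a j *: c j.
    by move=> i; have [a [aE _]] := cP _ (Pb i); exists a.
  by exists (\matrix_(i, j) A i j) => i; rewrite AE; apply: eq_bigr => j _; rewrite mxE.
have [B BE] : exists B : 'M[k]_(m', n'), forall j, c j = \sum_i B j i *: b i.
  have /choice[B BE] : forall j, exists a : {ffun 'I_n' -> k}, c j = \sum_i a i *: b i.
    by move=> j; have [a [aE _]] := bP _ (Pc j); exists a.
  by exists (\matrix_(i, j) B i j) => j; rewrite BE; apply: eq_bigr => i _; rewrite mxE.
apply: (@mulmx1_min _ _ _ A B); apply/matrixP=> i l.
have [a [_ aU]] := bP _ (Pb i).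
have e1 : a = [ffun l => (A *m B) i l].
  apply: aU; rewrite {1}AE; under eq_bigr do rewrite BE scaler_sumr.
  rewrite exchange_big; apply: eq_bigr => j _; rewrite ffunE mxE scaler_suml.
  by apply: eq_bigr => j' _; rewrite scalerA.
have e2 : a = [ffun l => (1%:M : 'M_n') i l].
  apply: aU; rewrite (bigD1 i) //= big1 ?addr0 ?ffunE ?mxE ?eqxx ?scale1r // => j ji.
  by rewrite ffunE mxE eq_sym (negbTE ji) scale0r.
by move: e1; rewrite e2 => /ffunP/(_ l); rewrite !ffunE => <-.
Qed.

Lemma dimensionE V (P : V -> Prop) n : has_dim P n -> dimension P = n.
Proof.
rewrite /dimension => Pn; case: pselect => [e|]; last by case; exists n.
exact: has_dim_inj (projT2 (cid e)) Pn.
Qed.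

Lemma row_iso V n : has_dim (@fullspace k V) n ->
  exists (f : lmap V 'rV[k]_n) (g : lmap 'rV[k]_n V), f ∘ g = lid _ /\ g ∘ f = lid _.
Proof.
move=> [b [_ bP]].
have /choice[c cP] : forall v, exists c : {ffun 'I_n -> k}, v = \sum_i c i *: b i.
  by move=> v; have [c [cE _]] := bP v Logic.I; exists c.
have cU v (d : {ffun 'I_n -> k}) : v = \sum_i d i *: b i -> c v = d.
  move=> vE; have [e [_ eU]] := bP v Logic.I.
  by rewrite -(eU _ (cP v)) -(eU _ vE).
have lf : linear (fun v => \row_i c v i).
  move=> a v w; apply/rowP=> i; rewrite !mxE.
  rewrite (cU (a *: v + w) [ffun i => a * c v i + c w i]) ?ffunE //.
  rewrite {1}(cP v) {1}(cP w) scaler_sumr -big_split; apply: eq_bigr => j _.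
  by rewrite ffunE scalerDl scalerA.
have lg : linear (fun x : 'rV[k]_n => \sum_i x 0 i *: b i).
  move=> a x y; rewrite scaler_sumr -big_split; apply: eq_bigr => j _.
  by rewrite !mxE scalerDl scalerA.
exists (Lmap lf), (Lmap lg); split; apply: lmap_eq => x; rewrite lcompE /=.
  apply/rowP=> i; rewrite mxE (cU _ [ffun i => x 0 i]) ?ffunE //.
  by apply: eq_bigr => j _; rewrite ffunE.
by rewrite [RHS]cP; apply: eq_bigr => j _; rewrite mxE.
Qed.

(** The matrix trace in coordinates. For an idempotent, a rank factorization M = C R satisfies R C =
    1, so the trace is that of an identity matrix, and the rows of R give a basis of the range. *)
Lemma exists_trace V n : has_dim (@fullspace k V) n ->
  exists tr : lmap V V -> k,
  [/\ forall (J : finType) (F : J -> lmap V V), tr (\sum_j F j) = \sum_j tr (F j),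
      tr 0 = 0,
      forall f g, tr (f ∘ g) = tr (g ∘ f) &
      forall f, f ∘ f = f -> exists2 m, has_dim (range f) m & tr f = m%:R].
Proof.
move=> /row_iso[phi [psi [phiK psiK]]].
pose mx (f : lmap V V) := lin1_mx (phi ∘ f ∘ psi).
have mxE' f u : u *m mx f = phi (f (psi u)) by rewrite mul_rV_lin1.
have phiKE x : phi (psi x) = x by rewrite -[RHS]/(lid _ x) -phiK.
have psiKE x : psi (phi x) = x by rewrite -[RHS]/(lid _ x) -psiK.
have mxM f g : mx (f ∘ g) = mx g *m mx f.
  by apply/row_matrixP=> i; rewrite !rowE mulmxA !mxE' psiKE.
have mx_inj A B : (forall u : 'rV_n, u *m A = u *m B) -> A = B.
  by move=> AB; apply/row_matrixP=> i; rewrite !rowE.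
exists (fun f => \tr (mx f)); split.
- move=> J F; rewrite -raddf_sum; congr (\tr _); apply: mx_inj => u.
  by rewrite mxE' lsumE linear_sum mulmx_sumr; apply: eq_bigr => j _; rewrite mxE'.
- suff -> : mx 0 = 0 by rewrite mxtrace0.
  by apply: mx_inj => u; rewrite mxE' lzeroE linear0 mulmx0.
- by move=> f g; rewrite !mxM mxtrace_mulC.
move=> f ff; pose M := mx f.
have MM : M *m M = M by rewrite -mxM ff.
have [r [C [R [CR RC R_inj]]]] : exists r (C : 'M[k]_(n, r)) (R : 'M[k]_(r, n)),
    [/\ C *m R = M, R *m C = 1%:M & row_free R].
  exists (\rank M), (col_base M), (row_base M).
  split; [exact: mulmx_base | | exact: row_base_free].
  (* In C R C R = C R, [C] is cancelled on the left and [R] on the right. *)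
  apply: (row_free_inj (row_base_free M)); apply: (row_full_inj (col_base_full M)).
  by rewrite mul1mx -[_ *m _ *m row_base M]mulmxA mulmx_base mulmxA mulmx_base MM.
exists r; last by rewrite -/M -CR mxtrace_mulC RC mxtrace1.
have RM : R *m M = R by rewrite -CR mulmxA RC mul1mx.
exists (fun i => psi (row i R)); split.
  by move=> i; exists (psi (row i R)); rewrite -[RHS]psiKE -mxE' -/M -row_mul RM.
have sumE (c : 'I_r -> k) :
    phi (\sum_i c i *: psi (row i R)) = (\row_i c i) *m R.
  rewrite linear_sum mulmx_sum_row; apply: eq_bigr => i _.
  by rewrite linearZ /= phiKE mxE.
move=> v [x vE]; exists [ffun i => (phi x *m C) 0 i]; split.
  rewrite -[LHS]psiKE -[RHS]psiKE sumE; congr (psi _).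
  have -> : \row_i [ffun i => (phi x *m C) 0 i] i = phi x *m C.
    by apply/rowP=> i; rewrite mxE ffunE.
  by rewrite -mulmxA CR mxE' psiKE vE.
move=> d dE; apply/ffunP=> i; rewrite ffunE.
have := congr1 phi dE; rewrite sumE vE -{1}(psiKE x) -mxE' -/M -CR mulmxA.
by move=> /(row_free_inj R_inj) ->; rewrite mxE.
Qed.

(** [f] identifies [V] with the range of [f ∘ g], and [g] brings a basis of that range back. *)
Lemma has_dim_retract V W (f : lmap V W) (g : lmap W V) m :
  g ∘ f = lid _ -> has_dim (range (f ∘ g)) m -> has_dim (@fullspace k V) m.
Proof.
move=> gf [b [Pb bP]].
have gfE x : g (f x) = x by rewrite -[RHS]/(lid _ x) -gf.
exists (fun i => g (b i)); split=> // v _.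
have [c [cE cU]] := bP (f v) (ex_intro _ (f v) (esym (congr1 f (gfE v)))).
exists c; split.
  rewrite -[LHS]gfE cE linear_sum; apply: eq_bigr => i _.
  by rewrite linearZ.
move=> d dE; apply: cU; rewrite dE linear_sum; apply: eq_bigr => i _.
rewrite linearZ /=; congr (_ *: _).
by have [x ->] := Pb i; rewrite !lcompE gfE.
Qed.

Lemma direct_sum_idempotents V (J : finType) (E : J -> lmap V V) :
  \sum_j E j = lid V -> (forall i j, E i ∘ E j = if i == j then E i else 0) ->
  direct_sum (fun j => range (E j)).
Proof.
move=> E1 EE v; exists [ffun j => E j v]; split.
  split=> [j|]; first by rewrite ffunE; exists v.
  rewrite -[LHS]/(lid _ v) -E1 lsumE; apply: eq_bigr => j _.
  by rewrite ffunE.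
move=> w [wP vE]; apply/ffunP=> j; rewrite ffunE vE linear_sum (bigD1 j) //=.
rewrite big1 ?addr0 => [|i ij].
  by have [x ->] := wP j; rewrite -lcompE EE eqxx.
by have [x ->] := wP i; rewrite -lcompE EE eq_sym (negbTE ij).
Qed.

(* Composing ∑ E = 1 with E x on the left and E z on the right leaves, by
   induction on the interval [x, z], only the terms at x and z. *)
Lemma triangular_orthogonal V (J : finType) (le : rel J) (E : J -> lmap V V) :
  reflexive le -> antisymmetric le -> transitive le ->
  \sum_j E j = lid V -> (forall i, E i ∘ E i = E i) ->
  (forall i j, ~~ le i j -> E i ∘ E j = 0) ->
  forall i j, i != j -> E i ∘ E j = 0.
Proof.
move=> lexx le_anti le_trans E1 Eid E0 x z.
have [n] := ubnP #|[set y | le x y && le y z]|; elim: n z => // n IHn z leN xz.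
have [xlez|] := boolP (le x z); last exact: E0.
have : E x ∘ E z = \sum_y E x ∘ E y ∘ E z.
  by rewrite -lcomp_suml -lcomp_sumr E1 lcomp1r.
rewrite (bigD1 x) //= (bigD1 z) 1?eq_sym //= big1 => [|y /andP[yx yz]].
  (* The terms at [x] and [z] both equal [E x ∘ E z], so the equation has the form a = a + a. *)
  by rewrite Eid -lcompA Eid addr0 -[LHS]addr0 => /addrI <-.
have [xy|/E0->] := boolP (le x y); last by rewrite lcomp0l.
have [yz'|/E0] := boolP (le y z); last by rewrite -lcompA => ->; rewrite lcomp0r.
rewrite IHn ?lcomp0l 1?eq_sym // -ltnS (leq_trans _ leN) // ltnS.
apply: proper_card; apply/properP; split.
  by apply/subsetP=> t; rewrite !inE => /andP[-> ty]; apply: le_trans ty yz'.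
exists z; rewrite inE ?xlez ?lexx //=; apply: contraNN yz => zy.
by apply/eqP/le_anti; rewrite yz' zy.
Qed.

End LinearAlgebra.

(** * Set partitions and the orthogonality of the idempotents *)

Section Partitions.
Variable I : finType.
Implicit Types (A B C : {set I}) (X Y Z : set_partition I) (F : composition I).

Lemma set_partition_eq X B C x :
  B \in val X -> C \in val X -> x \in B -> x \in C -> B = C.
Proof.
have /and3P[_ /trivIsetP tX _] := valP X => BX CX xB xC.
apply/eqP; apply: contraTT (xC) => BC.
by rewrite (disjointFr (tX _ _ BX CX BC) xB).
Qed.

Lemma set_partition_nonempty X B : B \in val X -> exists x, x \in B.
Proof.
have /and3P[_ _ X0] := valP X => BX; apply/set0Pn.
by apply: contraNneq X0 => <-.
Qed.

Lemma set_partition_cover X x : exists2 B, B \in val X & x \in B.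
Proof.
have /and3P[/eqP cX _ _] := valP X; apply/bigcupP.
by rewrite -/(cover (val X)) cX inE.
Qed.

(** Refinement read from the finer side, as [run_comp_eq0] and [run_absorb] use it. A block of [Y]
    sharing a point with a union of blocks of [Y] is one of them. *)
Lemma part_leP X Y :
  reflect (forall C, C \in val Y -> exists2 B, B \in val X & C \subset B) (part_le X Y).
Proof.
apply: (iffP forall_inP) => [XY C CY|XY B BX].
  have [x xC] := set_partition_nonempty CY.
  have [B BX xB] := set_partition_cover X x.
  have /existsP[Z /andP[/subsetP ZY /eqP BZ]] := XY B BX.
  exists B => //; move: xB; rewrite BZ => /bigcupP[D DZ xD].
  by rewrite (set_partition_eq CY (ZY _ DZ) xC xD); apply: bigcup_sup.
apply/existsP; exists [set C in val Y | C \subset B]; apply/andP; split.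
  by apply/subsetP=> C; rewrite inE => /andP[].
apply/eqP/setP=> x; apply/idP/bigcupP => [xB|[C]]; last first.
  by rewrite inE => /andP[_ /subsetP CB] /CB.
have [C CY xC] := set_partition_cover Y x; exists C => //; rewrite inE CY /=.
have [B' B'X CB'] := XY C CY.
by rewrite (set_partition_eq BX B'X xB (subsetP CB' x xC)).
Qed.

Lemma part_lexx : reflexive (@part_le I).
Proof. by move=> X; apply/part_leP=> C CX; exists C. Qed.

Lemma part_le_trans : transitive (@part_le I).
Proof.
move=> Y X Z /part_leP XY /part_leP YZ; apply/part_leP=> C /YZ[D /XY[B BX DB] CD].
by exists B => //; apply: subset_trans CD DB.
Qed.

Lemma part_le_anti : antisymmetric (@part_le I).
Proof.
suff sub X Y : part_le X Y -> part_le Y X -> val Y \subset val X.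
  by move=> X Y /andP[XY YX]; apply/val_inj/eqP; rewrite eqEsubset !sub.
move=> /part_leP XY /part_leP YX; apply/subsetP=> C CY.
have [B BX CB] := XY C CY; have [C' C'Y BC'] := YX B BX.
have [x xC] := set_partition_nonempty CY.
have CC' := set_partition_eq CY C'Y xC (subsetP BC' _ (subsetP CB _ xC)).
suff -> : C = B by [].
by apply/eqP; rewrite eqEsubset CB CC' BC'.
Qed.

Lemma part_le_disjoint X Y B C : part_le X Y -> B \in val X -> C \in val Y ->
  C \subset B \/ C :&: B = set0.
Proof.
move=> /part_leP XY BX CY; have [B' B'X CB'] := XY C CY.
have [CB|/set0Pn[x]] := eqVneq (C :&: B) set0; first by right.
rewrite inE => /andP[xC xB]; left.
by rewrite (set_partition_eq BX B'X xB (subsetP CB' _ xC)).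
Qed.

Lemma pairwise_disjoint_uniq (s : seq {set I}) :
  all (fun B => B != set0) s -> pairwise_disjoint s -> uniq s.
Proof.
elim: s => [|B s IHs] //= /andP[B0 s0] /andP[/allP Bs ds]; rewrite IHs // andbT.
by apply: contraNN B0 => /Bs; rewrite -setI_eq0 setIid.
Qed.

Lemma pairwise_disjoint_trivIset (s : seq {set I}) :
  uniq s -> trivIset [set B in s] -> pairwise_disjoint s.
Proof.
elim: s => [|B s IHs] //= /andP[Bs us] /trivIsetP tr; apply/andP; split.
  apply/allP=> C Cs; apply: tr; rewrite ?inE ?eqxx ?Cs ?orbT //.
  by apply: contraNneq Bs => ->.
apply: IHs => //; apply/trivIsetP=> C D; rewrite !inE => Cs Ds.
by apply: tr; rewrite !inE ?Cs ?Ds orbT.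
Qed.

Lemma partition_composition (s : seq {set I}) : uniq s ->
  partition [set B in s] [set: I] = is_composition s.
Proof.
move=> us; rewrite /partition /is_composition.
have -> : cover [set B in s] = \bigcup_(B <- s) B.
  rewrite /cover big_uniq //=; apply: eq_bigl => B; by rewrite inE.
apply/and3P/and3P => -[].
  move=> uE tr s0; split=> //; last exact: pairwise_disjoint_trivIset.
  by apply/allP=> B Bs; apply: contraNneq s0 => <-; rewrite inE.
move=> s0 ds uE; split=> //; last first.
  by rewrite inE; apply/negP=> /(allP s0); rewrite eqxx.
apply/trivIsetP=> B C; rewrite !inE => Bs Cs BC.
have [E|] := pairwise_disjointP ds Bs Cs; first by rewrite E eqxx in BC.
by move/eqP; rewrite setI_eq0.
Qed.

Lemma blocks_uniq F : uniq (blocks F).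
Proof. by have /and3P[F0 dF _] := valP F; apply: pairwise_disjoint_uniq. Qed.

Lemma supp_partition F : partition (supp F) [set: I].
Proof. by rewrite partition_composition ?blocks_uniq //; apply: (valP F). Qed.

Lemma card_supp F : #|supp F| = size (blocks F).
Proof. by rewrite cardsE; apply/card_uniqP/blocks_uniq. Qed.

Lemma enum_composition X : is_composition (enum (val X)).
Proof.
by rewrite -partition_composition ?enum_uniq // set_enum; apply: (valP X).
Qed.

(** Compositions with support [X] are the orderings of its blocks. *)
Lemma big_supp (V : zmodType) X (Phi : seq {set I} -> V) :
  \sum_(F | supp F == val X) Phi (blocks F) =
  \sum_(s <- permutations (enum (val X))) Phi s.
Proof.
apply: big_compositions => [|s]; first exact: permutations_uniq.
rewrite mem_permutations; apply: (iffP idP) => [sX|[F /eqP FX <-]].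
  have us : uniq s by rewrite (perm_uniq sX) enum_uniq.
  have sE : [set B in s] = val X.
    by apply/setP=> B; rewrite inE (perm_mem sX) mem_enum.
  have [F FE] : exists F, blocks F = s.
    by apply: composition_exists; rewrite -partition_composition // sE (valP X).
  by exists F => //; rewrite /supp FE sE.
by apply: uniq_perm; rewrite ?blocks_uniq ?enum_uniq // => B; rewrite mem_enum -FX inE.
Qed.

Lemma sum_supp_const (k : pzRingType) X :
  \sum_(F | supp F == val X) 1 = (#|val X|)`!%:R :> k.
Proof.
rewrite (big_supp X (fun _ => 1)) big_const_seq count_predT -Monoid.iteropE.
by rewrite size_permutations ?enum_uniq // -cardE.
Qed.

End Partitions.

Section Idempotents.
Variables (k : fieldType) (h : bimonoid k) (I : finType).
Hypotheses (char0 : [pchar k] =i pred0) (I_nonempty : (0 < #|I|)%N).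
Hypotheses (h_connected : connected h) (h_cocommutative : cocommutative h).
Implicit Types (A B C S T : {set I}) (s t : seq {set I}) (F G : composition I).
Implicit Types X Y Z : set_partition I.

Local Notation H A := (h (sset A)).
Local Notation P := (run (@idfam k h I)).
Local Notation Q := (run (@logfam k h I)).
Local Notation E := (@EL k h I).

Let log_comon := logfam_comonoidal char0 h_connected h_cocommutative (U := I).

(** In each term [posfam] demands a nonempty first part and the remaining power a nonempty second
    one, but the logarithm has zero coproduct into two nonempty parts. *)
Lemma spow_logfam j A : spow (@posfam k h I) j.+2 A ∘ logfam h A = 0.
Proof.
rewrite -[spow _ _.+2 A]/(star (@posfam k h I) (spow (@posfam k h I) j.+1) A).
rewrite /star lcomp_suml big1 // => B BA.
rewrite (conv_comp _ _ _ log_comon) /primitive_weight.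
have [A0|A0] := eqVneq (A :&: B) set0.
  suff -> : posfam h (A :&: B) = 0 by rewrite lcomp0l conv0l scaler0.
  by rewrite A0 /posfam eqxx.
have [B0|B0] := eqVneq (A :\: B) set0; last by rewrite scale0r.
suff -> : spow (@posfam k h I) j.+1 (A :\: B) = 0.
  by rewrite lcomp0l linear0 scaler0.
by rewrite B0 spow_vanish ?cards0 // /posfam eqxx.
Qed.

(** Composed with a primitive family, the logarithm series keeps only its term of degree 1: degree 0
    has coefficient 0, and [spow_logfam] removes the higher ones. *)
Lemma logfam_idem A : logfam h A ∘ logfam h A = logfam h A.
Proof.
have [->|A0] := eqVneq A set0; first by rewrite logfam0 lcomp1l.
rewrite {1}/logfam (negbTE A0) /logc lcomp_sumZl.
rewrite -(prednK I_nonempty) !big_ord_recl big1 => [|j _].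
  rewrite !lift0 !binpoly_coef1 //= invr0 mulr0 scale0r add0r addr0.
  by rewrite star_unitr // /posfam (negbTE A0) lcomp1l divr1 scale1r.
by rewrite !lift0 spow_logfam scaler0.
Qed.

(** Some block of [Y] lies in no block of [X], so [run_comp_eq0] applies. The left family is the
    logarithm in [EL_eq0] and the identity in [P_EL_eq0]. *)
Lemma run_Q_eq0 (a : family h I) F G X Y :
  supp F = val X -> supp G = val Y -> ~~ part_le X Y ->
  run a (blocks F) [set: I] ∘ Q (blocks G) [set: I] = 0.
Proof.
move=> FX GY /part_leP XY.
have [C CY CX] : exists2 C, C \in val Y & forall B, B \in val X -> ~~ (C \subset B).
  apply: contrapT => nex; apply: XY => C CY; apply: contrapT => nB; apply: nex.
  by exists C => // B BX; apply/negP=> CB; apply: nB; exists B.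
have /and3P[_ _ /eqP uF] := valP F; have /and3P[_ dG _] := valP G.
have [x xC] := set_partition_nonempty CY.
apply: (run_comp_eq0 h_cocommutative a log_comon dG (C := C)).
- by move: CY; rewrite -GY inE.
- by rewrite setIT; apply/set0Pn; exists x.
- by rewrite uF subsetT.
- by move=> B BF; rewrite setIT CX // -FX inE.
Qed.

(** The composite is taken on each block, where the logarithm is idempotent; the order of blocks is
    that of the left factor. *)
Lemma Q_comp_same F G : supp F = supp G ->
  Q (blocks F) [set: I] ∘ Q (blocks G) [set: I] = Q (blocks F) [set: I].
Proof.
move=> FG; have /and3P[_ dF /eqP uF] := valP F; have /and3P[_ dG _] := valP G.
rewrite -uF (run_comp_same h_connected h_cocommutative _ log_comon) ?logfam0 //.
  have -> // : (fun A => logfam h A ∘ logfam h A) = @logfam k h I.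
  exact/functional_extensionality_dep/logfam_idem.
move=> B BF; have BS : B \in supp F by rewrite inE.
by move: BS; rewrite FG inE.
Qed.

Lemma EL_eq0 X Y : ~~ part_le X Y -> E X ∘ E Y = 0.
Proof.
move=> XY; rewrite /EL lcompZl lcompZr lcomp_suml big1 ?scaler0 // => F /eqP FX.
by rewrite lcomp_sumr big1 // => G /eqP GY; apply: run_Q_eq0 XY.
Qed.

Lemma EL_idem X : E X ∘ E X = E X.
Proof.
have n0 : (#|val X|)`!%:R != 0 :> k by rewrite (pcharf0P k).1 // -lt0n fact_gt0.
rewrite {1 3}/EL lcompZl lcomp_suml; congr (_ *: _); apply: eq_bigr => F /eqP FX.
rewrite /EL lcompZr lcomp_sumr.
(* Each of the ℓ(X)! orderings contributes the same operator, which cancels the normalization. *)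
have -> : \sum_(G | supp G == val X) Q (blocks F) [set: I] ∘ Q (blocks G) [set: I] =
          (#|val X|)`!%:R *: Q (blocks F) [set: I].
  rewrite -(sum_supp_const k X) scaler_suml; apply: eq_bigr => G /eqP GX.
  by rewrite Q_comp_same ?FX ?GX // scale1r.
by rewrite scalerA mulVf // scale1r.
Qed.

(** Summing over [X] gives every composition [F] the coefficient 1/ℓ(F)!; grouped by length, this is
    the exponential of the logarithm. *)
Lemma sum_EL : \sum_X E X = lid (H [set: I]).
Proof.
have -> : \sum_X E X = \sum_F (size (blocks F))`!%:R^-1 *: Q (blocks F) [set: I].
  rewrite /EL; under eq_bigr do rewrite scaler_sumr.
  rewrite (exchange_big_dep xpredT) //=; apply: eq_bigr => F _.
  rewrite (big_pred1 (exist _ (supp F) (supp_partition F))) /= ?card_supp //.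
  by move=> X; rewrite eq_sym -(inj_eq val_inj).
rewrite (@big_compositions I _ xpredT (all_compositions [set: I])
  (fun s => (size s)`!%:R^-1 *: Q s [set: I])); first last.
- move=> s; rewrite mem_all_compositions; apply: (iffP idP) => [/composition_exists[F <-]|[F _ <-]].
    by exists F.
  exact: (valP F).
- exact: all_compositions_uniq.
rewrite big_all_compositions (lid_spow_log char0 h_connected h_cocommutative).
apply: eq_bigr => l _; rewrite (spow_compositions (b := @logfam k h I)).
- rewrite scaler_sumr; apply: eq_big_seq => s.
  by rewrite mem_compositions => /andP[/eqP-> _].
- exact: logc_set0.
- by move=> B B0; rewrite /logfam (negbTE B0).
Qed.

Lemma EL_orthogonal X Y : E X ∘ E Y = if X == Y then E X else 0.
Proof.
case: eqVneq => [<-|XY]; first exact: EL_idem.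
exact: (triangular_orthogonal (@part_lexx I) (@part_le_anti I) (@part_le_trans I)
  sum_EL EL_idem EL_eq0 XY).
Qed.

Lemma EL_P_absorb X Y : part_le Y X -> E X ∘ P (enum (val Y)) [set: I] = E X.
Proof.
move=> YX; rewrite /EL lcompZl lcomp_suml; congr (_ *: _).
apply: eq_bigr => F /eqP FX; have /and3P[_ _ /eqP uF] := valP F.
apply: (run_absorb h_connected h_cocommutative) => [|B C BF]; first by rewrite uF.
rewrite mem_enum => CY; apply: part_le_disjoint YX CY _.
by rewrite -FX inE.
Qed.

Lemma P_EL_eq0 X Y : ~~ part_le Y X -> P (enum (val Y)) [set: I] ∘ E X = 0.
Proof.
move=> YX; have [F FE] := composition_exists (enum_composition Y).
have FY : supp F = val Y by apply/setP=> B; rewrite inE FE mem_enum.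
rewrite -FE /EL lcompZr lcomp_sumr big1 ?scaler0 // => G /eqP GX.
exact: run_Q_eq0 YX.
Qed.

Lemma P_idem Y : P (enum (val Y)) [set: I] ∘ P (enum (val Y)) [set: I] =
  P (enum (val Y)) [set: I].
Proof.
have /and3P[_ _ /eqP uY] := enum_composition Y.
apply: (run_absorb h_connected h_cocommutative) => [|B C]; first by rewrite uY.
by rewrite !mem_enum => BY CY; apply: part_le_disjoint (part_lexx Y) CY BY.
Qed.

End Idempotents.

(** * Direct sum decomposition and dimension formula *)

Theorem theorem117 (k : fieldType) (char0 : [pchar k] =i pred0)
    (I : finType) (I_nonempty : (0 < #|I|)%N)
    (h : bimonoid k) (h_connected : connected h)
    (h_cocommutative : cocommutative h) :
  direct_sum (fun X : set_partition I => range (Psi h (GR_idempotent k X))) /\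
  (finite_dimensional h ->
   forall X : set_partition I,
     (dimension (range (Psi h (GR_idempotent k X))))%:Z = kX h X).
Proof.
pose e (X : set_partition I) := glob (EL h X).
have PsiE X : Psi h (GR_idempotent k X) = e X.
  by rewrite /e -PsiL_GR.
have e1 : \sum_X e X = lid (h I) by rewrite -linear_sum /= sum_EL // glob_id.
have ee X Y : e X ∘ e Y = if X == Y then e X else 0.
  by rewrite glob_comp EL_orthogonal //; case: ifP => // _; rewrite linear0.
split.
  have -> : (fun X => range (Psi h (GR_idempotent k X))) = fun X => range (e X).
    by apply/funext=> X; rewrite PsiE.
  exact: direct_sum_idempotents.
move=> h_fin X; have [n /exists_trace[tr [tr_sum tr0 trC tr_idem]]] := h_fin I.
pose f (X : set_partition I) := dimension (range (e X)).
have trE Y : tr (e Y) = (f Y)%:R.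
  have [|m dm ->] := tr_idem (e Y); first by rewrite ee eqxx.
  by rewrite /f (dimensionE dm).
(* The idempotent [p] has image a copy of h(Y); its trace is computed by splitting the identity into
   the [e Z]. *)
have dimE Y : dimension (fullspace (h_part h Y)) = (\sum_(Z | part_le Y Z) f Z)%N.
  pose c := enum_composition Y; pose p := glob (run (@idfam k h I) (enum (val Y)) [set: I]).
  have Y0 : enum (val Y) != [::].
    have [F FE] := composition_exists c.
    by rewrite -FE blocks_nonempty.
  pose mu := Lmap (mu_seq_linear (h := h) c).
  pose De := Lmap (Delta_seq_linear (h := h) c).
  have pE : p = mu ∘ De by apply: lmap_eq => x; rewrite lcompE /= mu_Delta_seq.
  have De_mu : De ∘ mu = lid _ by apply: lmap_eq => x; rewrite lcompE /= Delta_mu_seq.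
  have pp : p ∘ p = p by rewrite /p glob_comp P_idem.
  have [m dm trp] := tr_idem p pp.
  have dY : has_dim (fullspace (h_part h Y)) m.
    by apply: (has_dim_retract De_mu); rewrite -pE.
  (* Dimensions are compared as scalars of [k], faithfully in characteristic 0. *)
  rewrite (dimensionE dY); apply: (natr_inj0 char0); rewrite -trp natr_sum.
  rewrite -[p]lcomp1r -e1 lcomp_sumr tr_sum [RHS]big_mkcond; apply: eq_bigr => Z _.
  case: ifP => [YZ|/negbT YZ]; last by rewrite glob_comp P_EL_eq0 // linear0 tr0.
  (* Under the trace the two factors may be exchanged, and then [e Z] absorbs [p]. *)
  by rewrite trC glob_comp EL_P_absorb // trE.
rewrite PsiE -/(f X) /kX.
(* Moebius inversion: after exchanging the sums, the coefficient of [f Z] is the sum of Moebius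
   values over the interval from [X] to [Z], which is 0 unless [Z = X]. *)
under eq_bigr => Y _ do rewrite dimE -natz natr_sum mulr_sumr.
rewrite (exchange_big_dep (part_le X)) /= => [|Y Z XY YZ]; last first.
  exact: part_le_trans XY YZ.
under eq_bigr => Z XZ.
  rewrite -mulr_suml moebius_sum //; first over.
  - exact: part_lexx.
  - exact: part_le_anti.
  - exact: part_le_trans.
rewrite (bigD1 X) ?part_lexx //= eqxx mul1r big1 ?addr0 ?natz // => Z /andP[_ ZX].
by rewrite eq_sym (negbTE ZX) mul0r.
Qed.
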